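(* Let $d\ge 2$, $\gamma>0$ and $\lambda>0$. With probability one, $K_{\gamma,\lambda}$ is a closed unbounded hyperbolic polyhedron with locally finite but countably infinite face structure. Moreover, with probability one, its closure in $\mathbb{H}^d\cup\partial_\infty\mathbb{H}^d$ satisfies $$\operatorname{cl}(K_{\gamma,\lambda})\cap\partial_\infty\mathbb{H}^d=\{\infty\}.$$
   Context: $\mathbb{H}^d$ is $d$-dimensional hyperbolic space of constant curvature $-1$ in the upper halfspace model $\mathbb{R}^{d-1}\times(0,\infty)$, with points $(v,y)$, metric $ds^2=y^{-2}(dv_1^2+\dots+dv_{d-1}^2+dy^2)$ and volume measure $\mathrm{vol}_{\mathbb{H}^d}(A)=\int_A y^{-d}\,dv\,dy$. The ideal boundary is $\partial_\infty\mathbb{H}^d=\mathbb{R}^{d-1}\cup\{\infty\}$, where points of $\mathbb{R}^{d-1}$ are approached as $y\downarrow0$ and $\mathbb{H}^d\cup\partial_\infty\mathbb{H}^d$ is the usual compactification (the one-point compactification of $\mathbb{R}^{d-1}\times[0,\infty)$). The closed horoball based at $\infty$ is $B_\lambda^\infty=\{(v,y)\in\mathbb{H}^d:y\ge\lambda\}$. Let $\eta_\gamma$ be a Poisson point process on $\mathbb{H}^d$ with intensity measure $\gamma\,\mathrm{vol}_{\mathbb{H}^d}$, and $\eta_{\gamma,\lambda}:=\eta_\gamma\cap B_\lambda^\infty$. A set is geodesically convex if it contains the geodesic segment between any two of its points; $\operatorname{conv}(X)$ is the intersection of all geodesically convex sets containing $X$ (no closure is taken). Put $K_{\gamma,\lambda}:=\operatorname{conv}(\eta_{\gamma,\lambda})$.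 A hyperbolic polyhedron is a closed, geodesically convex subset of $\mathbb{H}^d$ whose boundary is supported by totally geodesic hypersurfaces and whose set of faces is locally finite, i.e. every compact subset of $\mathbb{H}^d$ meets only finitely many faces (there may be infinitely many faces globally). *)

(* Defs.v *)
From HB Require Import structures.
From mathcomp Require Import all_boot all_order all_algebra.
From mathcomp Require Import all_classical all_reals all_analysis.
From mathcomp Require Import measurable_realfun.

Set Implicit Arguments.
Unset Strict Implicit.
Unset Printing Implicit Defensive.

Import Order.TTheory GRing.Theory Num.Theory.
Import numFieldNormedType.Exports.

Local Open Scope ring_scope.
Local Open Scope classical_set_scope.

(** * Upper halfspace model

    A point (v, y) of R^(d-1) x R is a pair [p] with [p.1 = v] and [p.2 = y].
    [hyp R d] carries the subspace topology, which is also the topology of the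
    hyperbolic metric; [closed], [compact], [connected], ... on [set (hyp R d)]
    are therefore relative to hyperbolic space. *)

Notation ambient R d := ('rV[R]_(d.-1) * R)%type.

Notation hyp R d := (set_type [set p : ambient R d | 0 < p.2]).

Section HyperbolicSpace.
Context {R : realType} {d : nat}.

Definition sqnorm (v : 'rV[R]_(d.-1)) : R := \sum_j v 0 j ^+ 2.

(** The metric tensor ds^2 = y^-2 (dv_1^2 + ... + dv_(d-1)^2 + dy^2) at [p],
    evaluated on the tangent vector [u]. *)
Definition metric_tensor (p u : ambient R d) : R :=
  (sqnorm u.1 + u.2 ^+ 2) / p.2 ^+ 2.

Definition C1_curve (c : R -> ambient R d) : Prop :=
  [/\ forall t, 0 < (c t).2, forall t, derivable c t 1 & continuous c^`()].

Definition curve_length (c : R -> ambient R d) : \bar R :=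
  (\int[lebesgue_measure]_(t in `[0%R, 1%R])
     (Num.sqrt (metric_tensor (c t) (derive1 c t)))%:E)%E.

Definition hyp_dist (p q : hyp R d) : \bar R :=
  ereal_inf [set curve_length c | c in
    [set c | [/\ C1_curve c, c 0 = \val p & c 1 = \val q]]].

Definition hyp_bounded (A : set (hyp R d)) : Prop :=
  exists r : R, forall p q, A p -> A q -> (hyp_dist p q <= r%:E)%E.

(** Complete geodesics with constant-speed parametrization. The last two clauses
    are the geodesic equation c'' + Gamma(c', c') = 0 of the metric above, whose
    nonzero Christoffel symbols are Gamma^i_(i y) = Gamma^i_(y i) = -1/y,
    Gamma^y_(i i) = 1/y (i < d-1) and Gamma^y_(y y) = -1/y. Constant curves are
    included, as the geodesics from a point to itself. *)
Definition geodesic (c : R -> ambient R d) : Prop :=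
  [/\ forall t, 0 < (c t).2,
      forall t, derivable c t 1 /\ derivable c^`() t 1,
      forall t, (c^`()^`() t).1 =
        (2 * (c^`() t).2 / (c t).2) *: (c^`() t).1
    & forall t, (c^`()^`() t).2 =
        ((c^`() t).2 ^+ 2 - sqnorm (c^`() t).1) / (c t).2].

(** [z] is the point with parameter [t] of the geodesic segment from [p] (at
    [t = 0]) to [q] (at [t = 1]). *)
Definition segment_point (p q : hyp R d) (t : R) (z : hyp R d) : Prop :=
  exists c, [/\ geodesic c, c 0 = \val p, c 1 = \val q & c t = \val z].

Definition geodesically_convex (A : set (hyp R d)) : Prop :=
  forall p q t z, A p -> A q -> 0 <= t <= 1 -> segment_point p q t z -> A z.

Definition hyp_conv (X : set (hyp R d)) : set (hyp R d) :=
  smallest geodesically_convex X.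

(** A closed connected hypersurface, given near each of its points [p] as the
    zero set of a C^1 function [f] with nonzero differential, which contains
    every complete geodesic tangent to it at [p]: since [f] is a local defining
    function, tangency of [c] at [p = c 0] means (f o c)'(0) = 0. *)
Definition totally_geodesic_hypersurface (S : set (hyp R d)) : Prop :=
  [/\ S !=set0, closed S, connected S &
      forall p, S p -> exists f : ambient R d -> R,
        [/\ \forall q \near \val p, differentiable f q /\
              forall u, {for q, continuous (fun x => 'D_u f x)},
            exists u, 'D_u f (\val p) != 0,
            \forall q \near p, S q <-> f (\val q) = 0 &
            forall c, geodesic c -> c 0 = \val p -> (f \o c)^`() 0 = 0 ->
              forall t z, c t = \val z -> S z]].

(** [S] supports [A] at [x]: it passes through the point [x] of [A], and [A] lies
    in one of the two closed halfspaces bounded by [S], that is, [A `\` S] stays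
    in a single connected component of the complement of [S]. *)
Definition supports_at (S A : set (hyp R d)) (x : hyp R d) : Prop :=
  [/\ totally_geodesic_hypersurface S, S x, A x &
      exists C, [/\ connected C, C `<=` ~` S & A `\` S `<=` C]].

(** Nonempty faces of all dimensions of a geodesically convex set, the set itself
    included: convex subsets containing both endpoints of any segment of [A]
    that they meet in a relatively interior point. *)
Definition face (A F : set (hyp R d)) : Prop :=
  [/\ F !=set0, F `<=` A, geodesically_convex F &
      forall p q t z, A p -> A q -> 0 < t < 1 -> segment_point p q t z ->
        F z -> F p /\ F q].

Definition hyperbolic_polyhedron (A : set (hyp R d)) : Prop :=
  [/\ closed A, geodesically_convex A,
      forall x, (closure A `\` interior A) x -> exists S, supports_at S A x
    & forall C, compact C -> finite_set [set F | face A F /\ F `&` C !=set0]].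

Definition horoball_infty (lambda : R) : set (hyp R d) :=
  [set p | lambda <= (\val p).2].

End HyperbolicSpace.

(** * Compactification *)

Notation closed_halfspace R d := (set_type [set p : ambient R d | 0 <= p.2]).

(** Hyperbolic space together with its ideal boundary; [None] is the ideal
    point infinity. *)
Notation hyp_compactification R d :=
  (one_point_compactification (closed_halfspace R d)).

Section Compactification.
Context {R : realType} {d : nat}.

Lemma hyp_closed_halfspace (p : hyp R d) :
  \val p \in [set p : ambient R d | 0 <= p.2].
Proof. by case: p => p hp; apply/mem_set/ltW; exact: set_mem hp. Qed.

Definition hyp_incl (p : hyp R d) : hyp_compactification R d :=
  Some (exist _ (\val p) (hyp_closed_halfspace p)).

Definition ideal_boundary : set (hyp_compactification R d) :=
  [set z | if z is Some q then (\val q).2 = 0 else True].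

End Compactification.

(** * Hyperbolic volume *)

(** Lebesgue measure on R^n, as an iterated integral over the coordinates. *)
Fixpoint lebesgue_rV (R : realType) (n : nat) : set 'rV[R]_n -> \bar R :=
  match n return set 'rV[R]_n -> \bar R with
  | 0%N => fun A => (\1_A (0 : 'rV[R]_0))%:E
  | m.+1 => fun A => (\int[lebesgue_measure]_x
      lebesgue_rV [set w : 'rV[R]_m | A (row_mx (x%:M : 'rV[R]_1) w)])%E
  end.

Definition hyp_vol (R : realType) (d : nat) (A : set (hyp R d)) : \bar R :=
  (\int[lebesgue_measure]_(y in `]0%R, +oo[)
     ((y ^- d)%:E *
      lebesgue_rV [set v | [set \val p | p in A] (v, y)]))%E.

Definition hyp_borel (R : realType) (d : nat) : set (set (hyp R d)) :=
  <<s [set U : set (hyp R d) | open U] >>.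

(** * Poisson point processes *)

(** The Poisson law with parameter in [0, +oo], as a function of its finite
    values: parameter 0 is the point mass at 0, parameter +oo the point mass
    at +oo. The second argument of [poisson_prob] is a dummy. *)
Definition poisson_law (R : realType) (mu : \bar R) (k : nat) : \bar R :=
  if mu is r%:E then poisson_prob r 0 [set k] else 0%E.

Definition npoints (R : realType) (d : nat) (X A : set (hyp R d)) : \bar R :=
  counting (X `&` A).

(** A Poisson point process with diffuse intensity [mu] is almost surely simple
    and is identified with its random set of points [eta]. Local finiteness is
    not imposed pointwise: it holds almost surely when [mu] is finite on compact
    sets. *)
Definition poisson_point_process (R : realType) (d : nat)
    (dT : measure_display) (T : measurableType dT) (P : probability T R)
    (mu : set (hyp R d) -> \bar R) (eta : T -> set (hyp R d)) : Prop :=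
  [/\ forall A, hyp_borel A -> measurable_fun setT (fun w => npoints (eta w) A : \bar R),
      forall A k, hyp_borel A ->
        P [set w | npoints (eta w) A = k%:R%:E] = poisson_law (mu A) k
    & forall (m : nat) (A : 'I_m -> set (hyp R d)) (B : 'I_m -> set (\bar R)),
        (forall i, hyp_borel (A i)) -> trivIset setT A ->
        (forall i, measurable (B i)) ->
        P [set w | forall i, B i (npoints (eta w) (A i))] =
        (\prod_(i < m) P [set w | B i (npoints (eta w) (A i))])%E].

(* Main.v *)
Require Import Defs.
From HB Require Import structures.
From mathcomp Require Import all_boot all_order all_algebra.
From mathcomp Require Import all_classical all_reals all_analysis.
From mathcomp Require Import measurable_realfun.
From mathcomp Require Import ring lra.

Set Implicit Arguments.
Unset Strict Implicit.
Unset Printing Implicit Defensive.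

Import Order.TTheory GRing.Theory Num.Theory.
Import numFieldNormedType.Exports.

Local Open Scope ring_scope.
Local Open Scope classical_set_scope.

(** The map [(v, y) |-> (v, |v|^2 + y^2)] sends the upper halfspace onto the part of
    [R^(d-1) x R] above the paraboloid [h = |v|^2]. Along a geodesic both [v] and
    [|v|^2 + y^2] have derivatives that are constant multiples of [y^2], so the image of
    a geodesic runs along a chord ([geodesic_chord]); conversely an explicit
    formula joins any two points by a geodesic ([geodesic_exists]). Hence geodesic
    convexity, geodesic hulls and faces become the usual notions of convex geometry
    ([geodesically_convexP], [chord_map_hull], [faceP]), hemispheres become
    non-vertical hyperplanes, and the horoball becomes the convex set
    [lambda^2 + |v|^2 <= h].

    About the Poisson process only two facts matter. The part of the horoball over a
    bounded cube of [R^(d-1)] has finite volume, so almost surely it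
    contains finitely many points; the part over an orthant has infinite volume, however
    far the orthant is moved out, so almost surely it contains a point. Countably
    many cubes and orthants suffice.

    The rest is deterministic. Let [X] be the image of such a set of points above the
    paraboloid, and [K] its convex hull in the linear sense. Points of [X] surround
    every point of [R^(d-1)], and heights grow quadratically with the distance, so
    [K] meets every vertical line in an upward ray ([hull_ray_up]), and over a
    bounded region its lower boundary below a given height comes from a finite
    subset of [X] ([hull_finite_reduction]). This makes [K] closed. The points of a
    vertical ray other than its endpoint are interior to [K], so a boundary point is
    lowest on its vertical line and has a supporting hyperplane that is not vertical
    ([hull_supporting_hyperplane]).

    A face other than [K] consists of lowest points. By the quadratic growth, if it
    contains a point over a given cube, then all points of [X] on it lie over a larger
    cube ([cface_points_bounded]). As a face is the hull of the points of [X]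
    on it, only finitely many faces meet a compact set, and there are countably many
    in all. There are infinitely many, because the proper faces are bounded and
    together reach every vertical line.

    Finally, the hull stays in the horoball, away from the finite part of the ideal
    boundary, and it contains points of arbitrary height, so it is unbounded and
    adherent to the ideal point at infinity. *)

(** * Linear convexity *)

Section Convex.
Context {R : realType} {E : lmodType R}.
Implicit Types (A B F X : set E) (p q : E) (t : R).

(** Real parameters with an explicit bound match the form in which parameters of
    geodesic segments occur. *)
Definition convex A :=
  forall p q t, A p -> A q -> 0 <= t <= 1 -> A ((1 - t) *: p + t *: q).

Definition chull X := smallest convex X.

(** The affine counterpart of [face]. *)
Definition cface A F :=
  [/\ F !=set0, F `<=` A, convex F &
      forall p q t, A p -> A q -> 0 < t < 1 -> F ((1 - t) *: p + t *: q) ->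
        F p /\ F q].

Lemma convex_comb A a b p q : convex A -> A p -> A q ->
  0 <= a -> 0 <= b -> a + b = 1 -> A (a *: p + b *: q).
Proof.
move=> cA Ap Aq a0 b0 ab1; have -> : a = 1 - b by rewrite -ab1 addrK.
by apply: cA => //; rewrite b0 -ab1 lerDr.
Qed.

Lemma chull_convex X : convex (chull X).
Proof.
move=> p q t Xp Xq t01 M [cM XM].
by apply: (cM) => //; [exact: (Xp M (conj cM XM))|exact: (Xq M (conj cM XM))].
Qed.

Lemma sub_chull X : X `<=` chull X.
Proof. by move=> p Xp M [_]; apply. Qed.

Lemma chull_sub X A : convex A -> X `<=` A -> chull X `<=` A.
Proof. by move=> cA XA p pX; exact: (pX A (conj cA XA)). Qed.

Lemma chullS X Y : X `<=` Y -> chull X `<=` chull Y.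
Proof. by move=> XY; apply: chull_sub (@chull_convex Y) _ => x /XY; exact: sub_chull. Qed.

Lemma chull0 : chull set0 = set0.
Proof. by rewrite -subset0; apply: chull_sub. Qed.

Lemma convexI A B : convex A -> convex B -> convex (A `&` B).
Proof. by move=> cA cB p q t [? ?] [? ?] ?; split; [apply: cA|apply: cB]. Qed.

Definition cjoin A B : set E :=
  [set z | exists p q t,
    [/\ A p, B q, 0 <= t <= 1 & z = (1 - t) *: p + t *: q]].

(** A combination of two points of the join regroups into a combination of one
    point of each side. When one side gets total weight 0, any point of that side
    will do. *)
Lemma cjoin_convex A B : convex A -> convex B -> convex (cjoin A B).
Proof.
move=> cA cB _ _ s [p [q [t [Ap Bq /andP[t0 t1] ->]]]]
  [p' [q' [t' [Ap' Bq' /andP[t'0 t'1] ->]]]] /andP[s0 s1].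
have regroup (C : set E) (x y : E) (a b : R) : convex C -> C x -> C y ->
    0 <= a -> 0 <= b -> exists2 z, C z & (a + b) *: z = a *: x + b *: y.
  move=> cC Cx Cy a0 b0.
  have [ab0|ab0] := eqVneq (a + b) 0.
    have /eqP := ab0; rewrite paddr_eq0// => /andP[/eqP -> /eqP ->].
    by exists x => //; rewrite addr0 !scale0r addr0.
  exists ((a / (a + b)) *: x + (b / (a + b)) *: y).
    have ab : 0 < a + b by rewrite lt_def ab0 addr_ge0.
    apply: convex_comb => //; rewrite ?divr_ge0// ?addr_ge0//.
    by rewrite -mulrDl divff.
  by rewrite scalerDr !scalerA; congr (_ *: _ + _ *: _); field.
have [s1' t1' t1''] : [/\ 0 <= 1 - s, 0 <= 1 - t & 0 <= 1 - t'] by rewrite !subr_ge0.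
have [z Az zE] := regroup A p p' ((1 - s) * (1 - t)) (s * (1 - t')) cA Ap Ap'
  (mulr_ge0 s1' t1') (mulr_ge0 s0 t1'').
have [w Bw wE] := regroup B q q' ((1 - s) * t) (s * t') cB Bq Bq'
  (mulr_ge0 s1' t0) (mulr_ge0 s0 t'0).
exists z, w, ((1 - s) * t + s * t'); split => //.
  by apply/andP; split; nra.
have -> : 1 - ((1 - s) * t + s * t') = (1 - s) * (1 - t) + s * (1 - t') by ring.
by rewrite zE wE !scalerDr !scalerA addrACA.
Qed.

Lemma chullU A B : convex A -> convex B ->
  chull (A `|` B) `<=` A `|` B `|` cjoin A B.
Proof.
move=> cA cB.
have [A0|/set0P[a Aa]] := eqVneq A set0.
  by rewrite A0 set0U => z Bz; left; exact: (chull_sub cB _ Bz).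
have [B0|/set0P[b Bb]] := eqVneq B set0.
  by rewrite B0 setU0 => z Bz; left; exact: (chull_sub cA _ Bz).
move=> z ABz; right; apply: (chull_sub _ _ ABz); first exact: cjoin_convex.
move=> x [Ax|Bx].
  by exists x, b, 0; split => //; rewrite ?lexx ?ler01// subr0 scale1r scale0r addr0.
by exists a, x, 1; split => //; rewrite ?lexx ?ler01// subrr scale1r scale0r add0r.
Qed.

(** A face which meets the inside of a segment contains its endpoints, so the
    points of [chull X] that are outside [F] or in [chull (X `&` F)] form a convex
    set, and this set contains [X]. Hence a face is determined by the points of [X]
    on it: counting faces reduces to counting subsets of [X]. *)
Lemma cface_chull X F : cface (chull X) F -> F = chull (X `&` F).
Proof.
move=> [F0 FX cF extr]; apply/seteqP; split; last first.
  by apply: chull_sub => // x [].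
suff H : chull X `<=` [set z | chull X z /\ (F z -> chull (X `&` F) z)].
  by move=> z Fz; have [_] := H z (FX z Fz); exact.
apply: chull_sub => [p q t [Xp Fp] [Xq Fq] t01|x Xx]; last first.
  by split=> [|Fx]; exact: sub_chull.
split=> [|Fz]; first exact: chull_convex.
have [t0|tn0] := eqVneq t 0.
  by move: Fz; rewrite t0 subr0 scale1r scale0r addr0.
have [t1|tn1] := eqVneq t 1.
  by move: Fz; rewrite t1 subrr scale1r scale0r add0r.
have t01' : 0 < t < 1 by rewrite !lt_def tn0 eq_sym tn1 /=.
have [Fp' Fq'] := extr p q t Xp Xq t01' Fz.
by apply: chull_convex => //; [exact: Fp|exact: Fq].
Qed.

End Convex.

Lemma finite_subsets {T : choiceType} (A : set T) :
  finite_set A -> finite_set [set B | B `<=` A].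
Proof.
move=> /finite_seqP[s ->].
pose f (m : (size s).-tuple bool) : set T := [set` mask m s].
apply: (@sub_finite_set _ _ (f @` setT)) => [B Bs|]; last first.
  exact/finite_image/finite_finset.
exists (map_tuple (fun x => x \in B) (in_tuple s)) => //.
rewrite /f -filter_mask; apply/seteqP; split=> x /=; rewrite mem_filter.
  by move=> /andP[/set_mem].
by move=> Bx; apply/andP; split; [apply/mem_set|exact: Bs].
Qed.

Lemma finite_set_bound {R : realType} {T : Type} (D : set T) (P : T -> R -> Prop) :
  (forall x r s, P x r -> r <= s -> P x s) ->
  finite_set D -> (forall x, D x -> exists r, P x r) ->
  exists r, forall x, D x -> P x r.
Proof.
move=> Pmono; elim/Pchoice: T => T in D P Pmono *.
move=> /finite_seqP[s ->].
elim: s => [|x s IH] Ds; first by exists 0.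
have [r Pr] := IH (fun y ys => Ds y (@mem_behead _ (x :: s) y ys)).
have [r' Pr'] := Ds x (mem_head x s).
exists (Num.max r r') => y /=; rewrite inE => /orP[/eqP ->|ys].
  by apply: Pmono Pr' _; rewrite le_max lexx orbT.
by apply: Pmono (Pr y ys) _; rewrite le_max lexx.
Qed.

(** Adding one point [x] to a finite set replaces its hull by the union of
    segments from [x], which is the image of a compact product. *)
Lemma chull_compact {R : realType} {E : normedModType R} (X : set E) :
  finite_set X -> compact (chull X).
Proof.
move=> /finite_seqP[s ->].
elim: s => [|x s IH].
  by rewrite set_nil chull0; exact: compact0.
have -> : chull [set` x :: s] =
    [set x] `|` chull [set` s] `|`
      (fun u : R * E => (1 - u.1) *: x + u.1 *: u.2) @` (`[0, 1] `*` chull [set` s]).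
  apply/seteqP; split=> z.
    move=> /(@chullS _ _ _ ([set x] `|` chull [set` s])) zs.
    have {}zs : chull ([set x] `|` chull [set` s]) z.
      apply: zs => y /=; rewrite inE => /orP[/eqP ->|ys]; first by left.
      by right; exact: sub_chull.
    have c1 : convex [set x].
      by move=> _ _ t -> -> _; rewrite -scalerDl subrK scale1r.
    have [xs|] := chullU c1 (@chull_convex _ _ [set` s]) zs; first by left.
    move=> [_ [q [t [-> sq t01 ->]]]]; by right; exists (t, q).
  move=> [[->|]|[[t q] /= [+ sq <-]]].
  - by apply: sub_chull; rewrite /= mem_head.
  - by apply: chullS => y ys; rewrite /= inE ys orbT.
  - rewrite in_itv/= => t01; apply: chull_convex => //.
      by apply: sub_chull; rewrite /= mem_head.
    by apply: chullS sq => y ys; rewrite /= inE ys orbT.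
apply: compactU; first by apply: compactU => //; exact: compact_set1.
apply: continuous_compact; last first.
  by apply: compact_setX => //; exact: segment_compact.
apply: continuous_subspaceT => u; apply: cvgD; apply: cvgZ.
- by apply: cvgB; [exact: cvg_cst|exact: cvg_fst].
- exact: cvg_cst.
- exact: cvg_fst.
- exact: cvg_snd.
Qed.

(** * Convex hulls of configurations above a paraboloid *)

Section Sqnorm.
Context {R : realType} {d : nat}.
Local Notation V := 'rV[R]_(d.-1).
Local Notation W := (V * R)%type.
Implicit Types (v w : V) (p q : W) (r s t : R).

Definition dotp v w : R := \sum_j v 0 j * w 0 j.

Lemma scale_realE s t : s *: t = s * t.
Proof. by []. Qed.

Lemma fst_comb s t p q : (s *: p + t *: q).1 = s *: p.1 + t *: q.1.
Proof. by []. Qed.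

Lemma snd_comb s t p q : (s *: p + t *: q).2 = s * p.2 + t * q.2.
Proof. by []. Qed.

Lemma dotp_comb v w w' s t : dotp v (s *: w + t *: w') = s * dotp v w + t * dotp v w'.
Proof.
rewrite /dotp !mulr_sumr -big_split; apply: eq_bigr => j _ /=.
by rewrite !mxE; ring.
Qed.

Lemma normr_coord v j : `|v 0 j| <= `|v|.
Proof. by rewrite [leRHS]/Num.norm/= mx_normrE; apply: (le_bigmax _ _ (0, j)). Qed.

Lemma sqr_coord_le_sqnorm v j : v 0 j ^+ 2 <= sqnorm v.
Proof.
by rewrite /sqnorm (bigD1 j)//= lerDl sumr_ge0// => i _; exact: sqr_ge0.
Qed.

Lemma sqnorm_ge0 v : 0 <= sqnorm v.
Proof. by rewrite /sqnorm sumr_ge0// => j _; exact: sqr_ge0. Qed.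

Lemma sqr_norm_le_sqnorm v : `|v| ^+ 2 <= sqnorm v.
Proof.
have [->|v0] := eqVneq v 0; first by rewrite normr0 expr0n sqnorm_ge0.
have [|[i j] vE] := @mx_norm_neq0 _ _ _ v; first by rewrite -normr_eq0 in v0.
by rewrite [`|v|]vE /= ord1 real_normK ?num_real// sqr_coord_le_sqnorm.
Qed.

Lemma sqnorm_convex v w t : 0 <= t <= 1 ->
  sqnorm ((1 - t) *: v + t *: w) <= (1 - t) * sqnorm v + t * sqnorm w.
Proof.
move=> /andP[t0 t1]; rewrite /sqnorm !mulr_sumr -big_split ler_sum// => j _ /=.
rewrite !mxE -subr_ge0 [leRHS](_ : _ = t * (1 - t) * (v 0 j - w 0 j) ^+ 2).
  by rewrite mulr_ge0 ?sqr_ge0// mulr_ge0// subr_ge0.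
by ring.
Qed.

Lemma above_paraboloid_convex a : convex [set p : W | a + sqnorm p.1 <= p.2].
Proof.
move=> p q t /= hp hq t01; have := sqnorm_convex p.1 q.1 t01.
move: t01 => /andP[t0 t1].
by rewrite !scale_realE; nra.
Qed.

Lemma strictly_above_paraboloid_convex : convex [set p : W | sqnorm p.1 < p.2].
Proof.
move=> p q t /= hp hq t01; have := sqnorm_convex p.1 q.1 t01.
move=> h; apply: (le_lt_trans h); rewrite !scale_realE.
move: t01 => /andP[]; rewrite le_eqVlt => /predU1P[<- _|t0 t1]; first by lra.
by nra.
Qed.

(** The sign pattern [e] selects an orthant of the horizontal space. *)
Definition spread (X : set W) := forall r (e : 'I_(d.-1) -> bool),
  exists2 p, X p & forall j, r <= (-1) ^+ e j * p.1 0 j.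

(** One point of [X] is chosen in each orthant, and the coordinates of [v] are
    reached one after the other: a point with the right [k]-th coordinate lies on
    the segment between two points whose [k]-th coordinates are large and of
    opposite signs and which agree in the coordinates treated before. The chosen
    points being finitely many, their heights and positions are bounded. *)
Lemma finite_hull_over_cube X r : spread X -> exists s M : R,
  forall v, `|v| <= r -> exists2 h, h <= M &
    chull (X `&` [set p | `|p.1| <= s]) (v, h).
Proof.
move=> Xspread.
have /choice[P HP] : forall e : {ffun 'I_(d.-1) -> bool}, exists p, X p /\
    forall j, r <= (-1) ^+ e j * p.1 0 j.
  by move=> e; have [p Xp ep] := Xspread r e; exists p.
exists (\sum_e `|(P e).1|), (\sum_e `|(P e).2|) => v vr.
set M := \sum_e `|(P e).2|; set Y := chull _.
have claim k : (k <= d.-1)%N -> forall e : 'I_(d.-1) -> bool, exists p, [/\ Y p,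
    p.2 <= M & forall j : 'I_(d.-1), if (j < k)%N then p.1 0 j = v 0 j
                 else r <= (-1) ^+ e j * p.1 0 j].
  elim: k => [_ e|k IH kd e].
    exists (P (finfun e)); have [XP eP] := HP (finfun e); split.
    - apply: sub_chull; split => //=.
      by rewrite (bigD1 (finfun e))//= lerDl sumr_ge0.
    - by rewrite (le_trans (ler_norm _))// /M (bigD1 (finfun e))//= lerDl sumr_ge0.
    - by move=> j; have := eP j; rewrite ffunE.
  pose k' := Ordinal kd.
  pose e' b j := if j == k' then b else e j.
  have [p [Yp pM ep]] := IH (ltnW kd) (e' false).
  have [q [Yq qM eq]] := IH (ltnW kd) (e' true).
  have := ep k'; have := eq k'; rewrite /= ltnn /e' eqxx expr1 expr0 mul1r mulN1r.
  set a := p.1 0 k'; set b := q.1 0 k' => rb ra.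
  have /ler_normlP[vr1 vr2] : `|v 0 k'| <= r := le_trans (normr_coord v k') vr.
  have va : v 0 k' <= a by lra.
  have bv : b <= v 0 k' by lra.
  pose t := (a - v 0 k') / (a - b).
  have t01 : 0 <= t <= 1.
    have [ab|ab] := eqVneq (a - b) 0.
      by rewrite /t ab invr0 mulr0 lexx ler01.
    have ab0 : 0 < a - b by rewrite lt_def ab subr_ge0 (le_trans bv va).
    by rewrite /t divr_ge0 ?subr_ge0// ?(le_trans bv va)//= ler_pdivrMr// mul1r lerB.
  have vE : (1 - t) * a + t * b = v 0 k'.
    rewrite /t; have [ab|ab] := eqVneq (a - b) 0; last by field.
    by rewrite ab invr0; lra.
  exists ((1 - t) *: p + t *: q); split; first exact: chull_convex.
    by rewrite snd_comb; move: t01 => /andP[]; nra.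
  move=> j; rewrite fst_comb !mxE ltnS leq_eqVlt.
  have [jk|jk] := eqVneq (j : nat) k.
    have -> : j = k' by apply/val_inj.
    by rewrite ltnn.
  have jk' : (j == k') = false by apply/negbTE; rewrite -val_eqE.
  have := ep j; have := eq j; rewrite /e' jk' /=; case: ifP => _.
    by move=> -> ->; rewrite -mulrDl subrK mul1r.
  move=> h1 h2; have : 0 <= t by case/andP: t01.
  by have : t <= 1 by [case/andP: t01]; nra.
have [p [Yp pM pv]] := claim _ (leqnn _) (fun=> false).
exists p.2 => //; suff <- : p.1 = v by rewrite -surjective_pairing.
by apply/rowP => j; have := pv j; rewrite ltn_ord.
Qed.

End Sqnorm.

Lemma norm_fst_le {R : realType} {U V : normedModType R} (p : U * V) : `|p.1| <= `|p|.
Proof. by rewrite prod_normE le_max lexx. Qed.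

Lemma norm_snd_le {R : realType} {U V : normedModType R} (p : U * V) : `|p.2| <= `|p|.
Proof. by rewrite prod_normE le_max lexx orbT. Qed.

(** The sum of a compact set and a closed ray is closed; here by the tube lemma,
    applied to the complement of a closed relation. *)
Lemma upper_set_closed {R : realType} {V : normedModType R} (C : set (V * R)) :
  compact C -> closed [set q | exists2 h, h <= q.2 & C (q.1, h)].
Proof.
move=> Ccpt p pU; apply: contrapT => npU.
pose D : set ((V * R) * (V * R)) := [set z | `|z.1.1 - z.2.1| <= 0] `&`
  [set z | z.1.2 - z.2.2 <= 0].
have cD : closed D.
  pose g1 (z : (V * R) * (V * R)) := `|z.1.1 - z.2.1|.
  pose g2 (z : (V * R) * (V * R)) := z.1.2 - z.2.2.
  have cts (U1 U2 U3 : topologicalType) (f : U1 -> U2) (g : U2 -> U3) :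
      continuous f -> continuous g -> continuous (g \o f).
    by move=> cf cg x; apply: continuous_comp; [exact: cf|exact: cg].
  have fst_continuous (U1 U2 : topologicalType) : continuous (@fst U1 U2).
    by move=> x; exact: cvg_fst.
  have snd_continuous (U1 U2 : topologicalType) : continuous (@snd U1 U2).
    by move=> x; exact: cvg_snd.
  have g1c : continuous g1.
    move=> z; apply: cvg_norm; apply: cvgB.
      exact: (cts _ _ _ _ _ (@fst_continuous _ _) (@fst_continuous V R) z).
    exact: (cts _ _ _ _ _ (@snd_continuous _ _) (@fst_continuous V R) z).
  have g2c : continuous g2.
    move=> z; apply: cvgB.
      exact: (cts _ _ _ _ _ (@fst_continuous _ _) (@snd_continuous V R) z).
    exact: (cts _ _ _ _ _ (@snd_continuous _ _) (@snd_continuous V R) z).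
  apply: closedI.
    exact: ((continuous_closedP g1).1 g1c _ (@closed_le R 0)).
  exact: ((continuous_closedP g2).1 g2c _ (@closed_le R 0)).
have near_p : \forall q \near p, C `<=` [set c | ~ D (c, q)].
  move/compact_near_coveringP : Ccpt => /(_ _ (nbhs p) (fun q c => ~ D (c, q))).
  apply => c Cc.
  have : open (~` D) by exact: closed_openC.
  rewrite openE => /(_ (c, p)) H; apply: H => -[/=].
  rewrite normr_le0 subr_eq0 => /eqP cp c2; apply: npU; exists c.2.
    by rewrite -subr_le0.
  by rewrite -cp -surjective_pairing.
have [q [[h hq Ch] qN]] := pU _ near_p.
by apply: (qN _ Ch); split => /=; rewrite ?subrr ?normr0// subr_le0.
Qed.

Section Configuration.
Context {R : realType} {d : nat} (d_gt1 : (0 < d.-1)%N).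
Local Notation V := 'rV[R]_(d.-1).
Local Notation W := (V * R)%type.
Implicit Types (v w : V) (p q : W) (r s t : R).
Context (X : set W) (a : R) (a_ge0 : 0 <= a).
Hypothesis Xabove : X `<=` [set p | a + sqnorm p.1 <= p.2].
Hypothesis Xfin : forall r, finite_set (X `&` [set p | `|p.1| <= r]).
Hypothesis Xspread : spread X.

Local Notation K := (chull X).

Lemma hull_above : K `<=` [set p | a + sqnorm p.1 <= p.2].
Proof. by apply: chull_sub => //; exact: above_paraboloid_convex. Qed.

Lemma hull_sqr_norm_le p : K p -> `|p.1| ^+ 2 <= p.2.
Proof.
move=> /hull_above/=; have := sqr_norm_le_sqnorm p.1; move: a_ge0; lra.
Qed.

Lemma hull_over_cube r : exists M, 
  forall v, `|v| <= r -> exists2 h, h <= M & K (v, h).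
Proof.
have [s [M H]] := finite_hull_over_cube r Xspread.
exists M => v /H[h hM Kh]; exists h => //.
by apply: chullS Kh => p [].
Qed.

(** Since heights grow quadratically, the points of [X] above height [h'] still form
    a spread configuration. Its hull, which stays above [h'], meets the vertical line
    over [v], and convexity fills the segment in between. *)
Lemma hull_ray_up v h h' : K (v, h) -> h <= h' -> K (v, h').
Proof.
move=> Kh hh'.
pose X' := X `&` [set p | h' <= p.2].
have X'spread : spread X'.
  move=> r e.
  have [p Xp pe] := Xspread (Num.max r (Num.max 1 h')) e.
  exists p; last first.
    by move=> j; apply: le_trans (pe j); rewrite le_max lexx.
  split => //=; have := pe (Ordinal d_gt1); set x := p.1 0 _.
  have := Xabove Xp; have := sqr_coord_le_sqnorm p.1 (Ordinal d_gt1); rewrite -/x /=.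
  rewrite !ge_max => x2 ap /and3P[_ x1 xh].
  have xx : x ^+ 2 = ((-1) ^+ e (Ordinal d_gt1) * x) ^+ 2.
    by rewrite exprMn sqrr_sign mul1r.
  by move: xx x1 xh a_ge0; set y := _ * x => xx x1 xh a0; nra.
have [s [M]] := finite_hull_over_cube `|v| X'spread.
move=> /(_ v (lexx _))[h2 _ X'h2].
have Kh2 : K (v, h2) by apply: chullS X'h2 => p [[]].
have h'h2 : h' <= h2.
  suff : [set p : W | h' <= p.2] (v, h2) by [].
  apply: chull_sub X'h2 => [p q t /= hp hq /andP[t0 t1]|p [[]]//].
  by rewrite !scale_realE; nra.
have [h2h|h2h] := eqVneq (h2 - h) 0.
  by have -> : h' = h by lra.
have h2h0 : 0 < h2 - h by rewrite lt_def h2h; lra.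
have := @chull_convex _ _ X (v, h) (v, h2) ((h' - h) / (h2 - h)) Kh Kh2.
have -> : 0 <= (h' - h) / (h2 - h) <= 1.
  by rewrite ler_pdivrMr// mul1r lerB// andbT divr_ge0// ?(ltW h2h0)// subr_ge0.
move=> /(_ isT); congr (K _); congr pair => /=.
  by rewrite -scalerDl subrK scale1r.
by rewrite !scale_realE; field.
Qed.

(** Over every point of a cube around [p.1] the hull has a point of height at most
    [M']. A point close to [p] lies above a combination of [(p.1, h1)] with such a
    point, which gets the small weight [e]. *)
Lemma hull_above_point_interior p h1 : K (p.1, h1) -> h1 < p.2 ->
  exists2 e, 0 < e &
    forall q, `|q.1 - p.1| <= e -> `|q.2 - p.2| <= e -> K q.
Proof.
move=> Kp hp; have [M HM] := hull_over_cube (`|p.1| + 1).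
pose M' := Num.max M h1.
have M'h1 : h1 <= M' by rewrite le_max lexx orbT.
have den0 : 0 < M' - h1 + 1 by lra.
(* At distance [e] the combination is at most [h1 + e * (M' - h1)] high, which has
   to stay below [p.2 - e]. *)
pose e := Num.min 1 ((p.2 - h1) / (M' - h1 + 1)).
have e0 : 0 < e by rewrite lt_min ltr01 divr_gt0// subr_gt0.
have e1 : e <= 1 by rewrite ge_min lexx.
have eh : e * (M' - h1 + 1) <= p.2 - h1.
  by rewrite -ler_pdivlMr// /e ge_min lexx orbT.
exists e => // -[v h] /= vp /ler_normlP[hp' _].
pose u := e^-1 *: (v - p.1).
have u1 : `|u| <= 1.
  by rewrite normrZ gtr0_norm ?invr_gt0// mulrC ler_pdivrMr// mul1r.
have [|m mM Km] := HM (p.1 + u).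
  by apply: (le_trans (ler_normD _ _)); rewrite lerD2l.
have vE : v = (1 - e) *: p.1 + e *: (p.1 + u).
  rewrite scalerDr addrA -scalerDl subrK scale1r /u scalerA divff ?gt_eqF//.
  by rewrite scale1r addrC subrK.
have := @chull_convex _ _ X _ _ e Kp Km; rewrite (ltW e0) e1 => /(_ isT).
set z := _ + _ => Kz.
have zE : z = (v, (1 - e) * h1 + e * m) by rewrite vE.
move: Kz; rewrite zE => Kz; apply: hull_ray_up Kz _.
have mM' : m <= M' by rewrite le_max mM.
by nra.
Qed.

(** Outside a large cube the points of [X] lie in a steep convex cone with apex
    over [v], at height at least [c]. If a point of the hull over [v] is a
    combination of a point [q] of the hull of the remaining finitely many points and
    of a point [b] of the cone, replacing [b] by a point of the hull over the unit cube around [v], in the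
    direction of [b], gives a point over [v] that is not higher. Thus below a given
    height the lower boundary of the hull is that of a finite set, which is what
    makes the hull closed. *)
Lemma hull_finite_reduction r c : exists s, forall p, K p -> `|p.1| <= r -> p.2 < c ->
  exists2 h, h <= p.2 & chull (X `&` [set q | `|q.1| <= s]) (p.1, h).
Proof.
have [s0 [M0 HM]] := finite_hull_over_cube (r + 1) Xspread.
pose M := Num.max M0 0; pose c' := Num.max c 0; pose r' := Num.max r 0.
have M_ge0 : 0 <= M by rewrite le_max lexx orbT.
have c'_ge0 : 0 <= c' by rewrite le_max lexx orbT.
have r'_ge0 : 0 <= r' by rewrite le_max lexx orbT.
have cc' : c <= c' by rewrite le_max lexx.
(* For [x] above this bound, [M * (x + r') + c' <= x ^+ 2]: distant points of [X] lie
   in the cone. *)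
pose s := Num.max s0 (M + M * r' + c' + 1).
have s0s : s0 <= s by rewrite le_max lexx.
have ss : M + M * r' + c' + 1 <= s by rewrite le_max lexx orbT.
exists s => -[v h] Kp /= vr hc.
set N := X `&` _.
pose cone : set W := [set q | M * `|q.1 - v| + c' <= q.2].
have cone_convex : convex cone.
  move=> q q' t; rewrite /cone /= => hq hq' /andP[t0 t1]; rewrite !scale_realE.
  have -> : (1 - t) *: q.1 + t *: q'.1 - v =
      (1 - t) *: (q.1 - v) + t *: (q'.1 - v).
    by rewrite !scalerBr addrACA -opprD -scalerDl subrK scale1r.
  have : `|(1 - t) *: (q.1 - v) + t *: (q'.1 - v)| <=
      (1 - t) * `|q.1 - v| + t * `|q'.1 - v|.
    apply: (le_trans (ler_normD _ _)).
    by rewrite !normrZ !ger0_norm// subr_ge0.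
  set x := `|_ + _|; set y := `|_|; set z := `|_ - _|.
  rewrite -/y -/z in hq hq' * => xyz.
  have : M * x <= M * ((1 - t) * y + t * z) by rewrite ler_wpM2l.
  by nra.
have : K `<=` chull (chull N `|` cone).
  apply: chull_sub; first exact: chull_convex.
  move=> q Xq; apply: sub_chull; have [qs|qs] := leP `|q.1| s.
    by left; apply: sub_chull.
  right; rewrite /cone /=.
  have : `|q.1 - v| <= `|q.1| + r'.
    rewrite (le_trans (ler_normB _ _))// lerD2l (le_trans vr)//.
    by rewrite le_max lexx.
  have := hull_sqr_norm_le (sub_chull Xq); move: qs.
  set x := `|q.1|; set y := `|q.1 - v| => qs xq yx.
  have : M * y <= M * (x + r') by rewrite ler_wpM2l.
  have Mr' : 0 <= M * r' by exact: mulr_ge0.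
  have x1 : 1 <= x by lra.
  have : 0 <= (x - 1) * (M * r') by rewrite mulr_ge0// subr_ge0.
  have : 0 <= (x - 1) * c' by rewrite mulr_ge0// subr_ge0.
  have : 0 <= x * (x - (M + M * r' + c' + 1)) by rewrite mulr_ge0//; lra.
  by nra.
move=> /(_ _ Kp)/(chullU (@chull_convex _ _ N) cone_convex).
case=> [[Np|]|[q [b [t [Nq cb /andP[t0 t1] pE]]]]]; first by exists h.
  rewrite /cone /= subrr normr0 mulr0 add0r => c'h.
  by move: (lt_le_trans hc cc'); rewrite ltNge c'h.
have h_ge0 : 0 <= h.
  by have := hull_sqr_norm_le Kp; apply: le_trans; exact: sqr_ge0.
(* The displacement [b.1 - v] is [rho] times [u], so [u] must receive the weight
   [t * rho] in place of [t]; [D] renormalises the weights. *)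
pose rho := `|b.1 - v|; pose D := (1 - t) + t * rho.
have rho0 : 0 <= rho by exact: normr_ge0.
have vE : v = (1 - t) *: q.1 + t *: b.1 by rewrite -fst_comb -pE.
have hE : h = (1 - t) * q.2 + t * b.2 by rewrite -snd_comb -pE.
have {}cb : M * rho + c' <= b.2 by [].
have t_neq1 : t != 1.
  apply: contra_ltN hc => /eqP t1E; rewrite (le_trans cc')// hE t1E subrr mul0r.
  by rewrite mul1r add0r; apply: le_trans cb; rewrite lerDr mulr_ge0.
have t1' : 0 < 1 - t by rewrite subr_gt0 lt_def eq_sym t_neq1.
have D0 : 0 < D by rewrite ltr_wpDr// mulr_ge0.
pose u := rho^-1 *: (b.1 - v).
have u1 : `|u| <= 1.
  rewrite normrZ ger0_norm ?invr_ge0// -/rho.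
  by have [->|rho_neq0] := eqVneq rho 0; rewrite ?mulr0// mulVf.
have uE : rho *: u = b.1 - v.
  rewrite /u; have [rho_eq0|rho_neq0] := eqVneq rho 0.
    by move/eqP: (rho_eq0); rewrite normr_eq0 => /eqP ->; rewrite !scaler0.
  by rewrite scalerA divff// scale1r.
clearbody u.
have [|m mM Nm] := HM (v + u).
  by apply: (le_trans (ler_normD _ _)); rewrite lerD.
exists ((1 - t) / D * q.2 + t * rho / D * m).
  have mM' : m <= M by rewrite le_max mM.
  have -> : (1 - t) / D * q.2 + t * rho / D * m =
      ((1 - t) * q.2 + t * rho * m) / D by field; rewrite gt_eqF.
  rewrite ler_pdivrMr// /D.
  have : t * (rho * m) <= t * (M * rho).
    by rewrite ler_wpM2l// mulrC ler_wpM2r.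
  have : 0 <= t * (b.2 - M * rho - c') by rewrite mulr_ge0//; lra.
  have : 0 <= h * (t * rho) by rewrite !mulr_ge0.
  have : t * h <= t * c' by rewrite ler_wpM2l// ltW// (lt_le_trans hc).
  by nra.
have Nm' : chull N (v + u, m).
  by apply: chullS Nm => z [Xz /= zs]; split => //=; exact: le_trans zs s0s.
suff -> : (v, (1 - t) / D * q.2 + t * rho / D * m) =
    ((1 - t) / D) *: q + (t * rho / D) *: ((v + u, m) : W).
  apply: convex_comb => //; first exact: chull_convex.
  - by rewrite divr_ge0// ltW.
  - by rewrite !mulr_ge0// invr_ge0 ltW.
  - by rewrite -mulrDl divff// gt_eqF.
congr pair => /=.
apply: (@scalerI _ _ D); first by rewrite gt_eqF.
rewrite scalerDr !scalerA -!(mulrC (D^-1)) !mulrA divff ?gt_eqF// !mul1r.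
apply/rowP => j; move/rowP/(_ j): vE; move/rowP/(_ j): uE; rewrite !mxE => uj vj.
have : t * rho * u 0 j = t * (b.1 0 j - v 0 j) by rewrite -mulrA uj.
by rewrite /D; move: vj; lra.
Qed.


Lemma hull_closed : closed K.
Proof.
move=> p pK.
have [s Hs] := hull_finite_reduction (`|p.1| + 1) (p.2 + 1).
pose U : set W := [set q | exists2 h, h <= q.2 &
  chull (X `&` [set q | `|q.1| <= s]) (q.1, h)].
suff [h hp Nh] : U p.
  rewrite [p]surjective_pairing; apply: hull_ray_up hp.
  by apply: chullS Nh => q [].
apply: upper_set_closed; first exact/chull_compact/Xfin.
move=> B pB; have [|q [Kq [Bq pq]]] := pK (B `&` ball p 1).
  by apply: filterI => //; exact: nbhsx_ballx.
exists q; split => //; rewrite -ball_normE /= in pq.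
have /ler_normlP[q2 _] : `|p.2 - q.2| <= `|p - q| := norm_snd_le (p - q).
have q1 : `|p.1 - q.1| <= `|p - q| := norm_fst_le (p - q).
apply: Hs => //; last by lra.
have -> : q.1 = p.1 - (p.1 - q.1) by rewrite subKr.
by rewrite (le_trans (ler_normB _ _))// lerD2l; lra.
Qed.

Lemma hull_lowest_point v :
  exists2 h, K (v, h) & forall h', K (v, h') -> h <= h'.
Proof.
pose H := [set h | K (v, h)].
have H_inf : has_inf H.
  split; first by have [M /(_ v (lexx _))[h _ Kh]] := hull_over_cube `|v|; exists h.
  exists 0 => h /hull_sqr_norm_le/=; apply: le_trans; exact: sqr_ge0.
exists (inf H); last by move=> h' Kh'; apply: ge_inf => //; case: H_inf.
apply: hull_closed => B /nbhs_ballP[e /= e0 eB].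
have [h Kh hH] := inf_adherent e0 H_inf.
exists (v, h); split=> //; apply: eB; split; first exact: ballxx.
have : inf H <= h by apply: ge_inf => //; case: H_inf.
by move=> Hh; rewrite /ball /= ltr_norml; lra.
Qed.

(** The linear functional is extended one coordinate at a time, as in the
    Hahn-Banach theorem: at each step the slopes towards the negative side of the new
    coordinate are bounded by those towards its positive side, since the segment
    between a point on each side crosses the subspace that was treated before. Both
    sides are inhabited because the hull meets every vertical line. *)
Lemma hull_supporting_hyperplane p : (forall h, K (p.1, h) -> p.2 <= h) ->
  exists b : V, forall q, K q -> p.2 + dotp b (q.1 - p.1) <= q.2.
Proof.
move=> plow.
suff H k : (k <= d.-1)%N -> exists b : V, forall q, K q ->
    (forall j : 'I_(d.-1), (k <= j)%N -> q.1 0 j = p.1 0 j) ->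
    p.2 + dotp b (q.1 - p.1) <= q.2.
  have [b Hb] := H _ (leqnn _); exists b => q Kq; apply: Hb => // j.
  by rewrite leqNgt ltn_ord.
elim: k => [_|k IH kd].
  exists 0 => q Kq qp.
  have -> : dotp 0 (q.1 - p.1) = 0.
    by rewrite /dotp big1// => j _; rewrite mxE mul0r.
  rewrite addr0; apply: plow; suff <- : q.1 = p.1 by rewrite -surjective_pairing.
  by apply/rowP => j; exact: qp.
have [b Hb] := IH (ltnW kd); pose j0 := Ordinal kd.
pose L := [set q | K q /\ forall j : 'I_(d.-1), (k < j)%N -> q.1 0 j = p.1 0 j].
pose gap q := q.2 - p.2 - dotp b (q.1 - p.1).
pose sh q := q.1 0 j0 - p.1 0 j0.
have Lcvx : convex L.
  move=> q q' t [Kq qp] [Kq' qp'] t01; split; first exact: chull_convex.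
  by move=> j kj; rewrite fst_comb !mxE qp// qp'//; ring.
have gap_comb q q' t : gap ((1 - t) *: q + t *: q') = (1 - t) * gap q + t * gap q'.
  rewrite /gap snd_comb fst_comb.
  have -> : (1 - t) *: q.1 + t *: q'.1 - p.1 =
      (1 - t) *: (q.1 - p.1) + t *: (q'.1 - p.1).
    by rewrite !scalerBr addrACA -opprD -scalerDl subrK scale1r.
  by rewrite dotp_comb; ring.
have gap0 q : L q -> sh q = 0 -> 0 <= gap q.
  move=> [Kq qp] /eqP; rewrite subr_eq0 => /eqP q0.
  suff : p.2 + dotp b (q.1 - p.1) <= q.2 by rewrite /gap; lra.
  apply: Hb => // j; rewrite leq_eqVlt => /predU1P[kj|]; last exact: qp.
  by have <- : j0 = j by exact: val_inj.
have Lsh x : exists2 q, L q & sh q = x.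
  pose w : V := p.1 + x *: delta_mx 0 j0.
  have [M /(_ w (lexx _))[h _ Kh]] := hull_over_cube `|w|.
  exists (w, h); last by rewrite /sh /w !mxE !eqxx mulr1 addrAC subrr add0r.
  split => // j kj; rewrite /w !mxE eqxx /=.
  have -> : (j == j0) = false.
    by apply/negbTE/eqP => jj; move: kj; rewrite jj ltnn.
  by rewrite mulr0 addr0.
have slopes q q' : L q -> L q' -> sh q < 0 -> 0 < sh q' ->
    gap q / sh q <= gap q' / sh q'.
  move=> Lq Lq' s0 s0'; pose t := - sh q / (sh q' - sh q).
  have den : 0 < sh q' - sh q by lra.
  have t01 : 0 <= t <= 1.
    rewrite /t ler_pdivrMr// mul1r; apply/andP; split; last by lra.
    by rewrite divr_ge0//; lra.
  have := gap0 _ (Lcvx _ _ _ Lq Lq' t01).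
  rewrite gap_comb {1}/sh fst_comb !mxE.
  have -> : (1 - t) * q.1 0 j0 + t * q'.1 0 j0 - p.1 0 j0 = (1 - t) * sh q + t * sh q'.
    by rewrite /sh; ring.
  have -> : (1 - t) * sh q + t * sh q' = 0 by rewrite /t; field; rewrite gt_eqF.
  move=> /(_ erefl).
  have -> : (1 - t) * gap q + t * gap q' =
      (sh q' * gap q - sh q * gap q') / (sh q' - sh q).
    by rewrite /t; field; rewrite gt_eqF.
  rewrite pmulr_lge0 ?invr_gt0// => num.
  rewrite ler_ndivrMr// mulrAC ler_pdivrMr//.
  by lra.
pose S := [set gap q / sh q | q in [set q | L q /\ sh q < 0]].
have S_sup : has_sup S.
  split.
    have [q Lq qs] := Lsh (-1); exists (gap q / sh q); exists q => //.
    by split => //; rewrite qs ltrN10.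
  have [q' Lq' qs'] := Lsh 1; exists (gap q' / sh q') => _ [q [Lq qs] <-].
  by apply: slopes => //; rewrite qs' ltr01.
exists (b + sup S *: delta_mx 0 j0) => q Kq qp.
have Lq : L q by [].
have -> : dotp (b + sup S *: delta_mx 0 j0) (q.1 - p.1) =
    dotp b (q.1 - p.1) + sup S * sh q.
  have -> : sup S * sh q =
      \sum_j sup S * (if j == j0 then q.1 0 j - p.1 0 j else 0).
    by rewrite -mulr_sumr -big_mkcond/= big_pred1_eq.
  rewrite /dotp -big_split; apply: eq_bigr => j _ /=; rewrite !mxE eqxx /=.
  by case: ifP => _; rewrite /=; ring.
suff : sup S * sh q <= gap q by rewrite /gap; lra.
have [s0|s0|s0] := ltgtP (sh q) 0.
- rewrite -ler_ndivrMr//; apply: ub_le_sup; first by case: S_sup.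
  by exists q.
- rewrite -ler_pdivlMr//; apply: ge_sup; first by case: S_sup.
  by move=> _ [q' [Lq' qs'] <-]; exact: slopes.
- by rewrite s0 mulr0; exact: gap0.
Qed.

(** A point of the hull which is not lowest on its vertical line is interior, so
    every segment from another point of the hull can be prolonged beyond it. *)
Lemma cface_nonlowest F q h : cface K F -> F q -> K (q.1, h) -> h < q.2 -> F = K.
Proof.
move=> [_ FK _ extr] Fq Kh hq; apply/seteqP; split => // y Ky.
have [e e0 eK] := hull_above_point_interior Kh hq.
pose m := `|q - y| + 1.
have m0 : 0 < m by rewrite ltr_wpDl.
pose D := e / m.
have D0 : 0 < D by exact: divr_gt0.
have Dm : D * `|q - y| <= e.
  rewrite /D -mulrA ger_pMr// mulrC ler_pdivrMr// mul1r /m; lra.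
pose q' := q + D *: (q - y).
have Kq' : K q'.
  have qq : q' - q = D *: (q - y) by rewrite /q' addrC addKr.
  have qD : `|q' - q| <= e by rewrite qq normrZ gtr0_norm.
  apply: eK; apply: le_trans qD; first exact: (norm_fst_le (q' - q)).
  exact: (norm_snd_le (q' - q)).
have D1 : 0 < 1 + D by lra.
pose t := D / (1 + D).
have t01 : 0 < t < 1 by rewrite /t ltr_pdivrMr// mul1r divr_gt0//=; lra.
suff qE : (1 - t) *: q' + t *: y = q.
  by have := extr q' y t Kq' Ky t01; rewrite qE => /(_ Fq)[].
have tE : 1 - t = (1 + D)^-1 by rewrite /t; field; rewrite gt_eqF.
apply: (@scalerI _ _ (1 + D)); first by rewrite gt_eqF.
rewrite scalerDr !scalerA tE divff ?gt_eqF// scale1r mulrC divfK ?gt_eqF//.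
by rewrite /q' scalerBr addrA subrK scalerDl scale1r.
Qed.

(** A segment from a point over a cube to a very distant point of [X] is, at
    horizontal distance 1 from its starting point, higher than some point of the
    hull, because the heights of points of [X] grow quadratically. A face containing
    this segment would be the whole hull. *)
Lemma cface_points_bounded r : exists s, forall F, cface K F -> F <> K ->
  (exists2 x, F x & `|x.1| <= r) -> X `&` F `<=` [set p | `|p.1| <= s].
Proof.
have [M0 HM] := hull_over_cube (r + 1).
pose M := Num.max M0 0; pose r' := Num.max r 0.
have M_ge0 : 0 <= M by rewrite le_max lexx orbT.
have r'_ge0 : 0 <= r' by rewrite le_max lexx orbT.
have rr' : r <= r' by rewrite le_max lexx.
(* At horizontal distance 1 the segment is at least [y ^+ 2 / rho] high, where
   [rho <= y + r'] is its horizontal length; this exceeds [M] beyond the bound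
   given here. *)
exists (r' + r' + M + 1) => F fF FK [x Fx xr] p [Xp Fp] /=.
rewrite leNgt; apply/negP => ps; apply: FK.
have [_ FK cF _] := fF.
pose rho := `|p.1 - x.1|.
have rho_ge : `|p.1| - r' <= rho.
  have : `|p.1| <= rho + `|x.1| by rewrite -{1}(subrK x.1 p.1) ler_normD.
  by move: (le_trans xr rr'); lra.
have rho_le : rho <= `|p.1| + r'.
  by rewrite (le_trans (ler_normB _ _))// lerD2l (le_trans xr).
have rho1 : 1 < rho by lra.
have rho0 : 0 < rho by lra.
pose z := (1 - rho^-1) *: x + rho^-1 *: p.
have t01 : 0 <= rho^-1 <= 1 by rewrite invr_ge0 (ltW rho0)/= invf_le1// ltW.
have Fz : F z by exact: cF.
have z1 : `|z.1| <= r + 1.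
  have -> : z.1 = x.1 + rho^-1 *: (p.1 - x.1).
    by rewrite /z fst_comb scalerBl scale1r scalerBr addrA addrAC.
  rewrite (le_trans (ler_normD _ _))// lerD// normrZ gtr0_norm ?invr_gt0//.
  by rewrite mulVf ?gt_eqF.
have [h hM Kh] := HM _ z1.
apply: (cface_nonlowest fF Fz Kh).
have hM' : h <= M by rewrite le_max hM.
apply: (le_lt_trans hM'); rewrite /z snd_comb.
have x2 : 0 <= x.2 by apply: le_trans (hull_sqr_norm_le (FK _ Fx)); exact: sqr_ge0.
have p2 := hull_sqr_norm_le (FK _ Fp).
apply: (@lt_le_trans _ _ (rho^-1 * p.2)); last first.
  by rewrite lerDr mulr_ge0// subr_ge0; case/andP: t01.
rewrite mulrC ltr_pdivlMr//; apply: lt_le_trans p2.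
have : M * rho <= M * (`|p.1| + r') by rewrite ler_wpM2l.
move: ps; set y := `|p.1| => ps My; apply: (le_lt_trans My).
have : 0 <= (y - (r' + r' + M + 1)) * y by apply: mulr_ge0; lra.
have : M * r' <= y * r' by rewrite ler_wpM2r//; lra.
have : 0 <= r' * y by apply: mulr_ge0; lra.
have : 0 < y by lra.
by nra.
Qed.

(** Faces are determined by their points of [X], which lie in one finite set. *)
Lemma cfaces_locally_finite r :
  finite_set [set F | cface K F /\ exists2 x, F x & `|x.1| <= r].
Proof.
have [s Hs] := cface_points_bounded r.
apply: (@sub_finite_set _ _ ([set K] `|`
    chull @` [set B | B `<=` X `&` [set p | `|p.1| <= s]])).
  move=> F [fF Fr]; have [->|/eqP FK] := eqVneq F K; first by left.
  right; exists (X `&` F); last by rewrite -cface_chull.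
  by move=> p [Xp Fp]; split => //; exact: (Hs F).
rewrite finite_setU; split; first exact: finite_set1.
exact/finite_image/finite_subsets/Xfin.
Qed.

(** Over every point [v] lies a point of a face other than [K]: the contact set of a
    supporting hyperplane at the lowest point over [v]. Each such face is bounded, so
    finitely many of them cannot lie over all points. *)
Lemma cfaces_infinite : infinite_set [set F | cface K F].
Proof.
move=> fin.
have {}fin : finite_set ([set F | cface K F] `&` [set F | F <> K]).
  by apply: sub_finite_set fin => F [].
have [||r Hr] := @finite_set_bound _ _ _
    (fun (F : set W) r => F `<=` [set p | `|p.1| <= r]) _ fin.
- by move=> F r s Fr rs p /Fr/= pr; exact: le_trans rs.
- move=> F [fF FK]; have [[x Fx] _ _ _] := fF.
  have [s Hs] := cface_points_bounded `|x.1|; exists s.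
  rewrite (cface_chull fF); apply: chull_sub; last first.
    by apply: Hs => //; exists x.
  move=> p q t /= ps qs /andP[t0 t1]; rewrite (le_trans (ler_normD _ _))//.
  rewrite !normrZ !ger0_norm ?subr_ge0//; nra.
pose v : V := const_mx (Num.max r 0 + 1).
have [h Kh hlow] := hull_lowest_point v.
have [b Hb] := @hull_supporting_hyperplane (v, h) hlow.
pose g (q : W) := q.2 - h - dotp b (q.1 - v).
have g_comb q q' t : g ((1 - t) *: q + t *: q') = (1 - t) * g q + t * g q'.
  rewrite /g snd_comb fst_comb.
  have -> : (1 - t) *: q.1 + t *: q'.1 - v =
      (1 - t) *: (q.1 - v) + t *: (q'.1 - v).
    by rewrite !scalerBr addrACA -opprD -scalerDl subrK scale1r.
  by rewrite dotp_comb; ring.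
have g_ge0 q : K q -> 0 <= g q by move=> /Hb/=; rewrite /g; lra.
have dotp0 : dotp b (v - v) = 0.
  by rewrite subrr /dotp big1// => j _; rewrite mxE mulr0.
pose F := K `&` [set q | g q = 0].
have Fv : F (v, h) by split => //; rewrite /g /= dotp0 subr0 subrr.
have fF : cface K F.
  split; [by exists (v, h)|by move=> ? []| |].
    apply: convexI; first exact: chull_convex.
    by move=> q q' t /= q0 q'0 _; rewrite g_comb q0 q'0 !mulr0 addr0.
  move=> q q' t Kq Kq' /andP[t0 t1] [_] /=; rewrite g_comb => /eqP.
  rewrite paddr_eq0 ?mulr_ge0 ?g_ge0// ?subr_ge0 ?ltW//.
  rewrite !mulf_eq0 subr_eq0 (gt_eqF t1) (gt_eqF t0) /= => /andP[/eqP ? /eqP ?].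
  by [].
have FK : F <> K.
  move=> FK; have Kh1 : K (v, h + 1) by apply: hull_ray_up Kh _; rewrite lerDl.
  by move: Kh1; rewrite -FK => -[_ /=]; rewrite /g /= dotp0; lra.
have /= := Hr F (conj fF FK) _ Fv.
have := normr_coord v (Ordinal d_gt1); rewrite mxE.
have : 0 <= Num.max r 0 by rewrite le_max lexx orbT.
have : r <= Num.max r 0 by rewrite le_max lexx.
move=> rm m0; rewrite ger0_norm ?addr_ge0//; lra.
Qed.

End Configuration.

(** * Geodesics and chords *)

Lemma is_derive_linear_comp {R : realType} {U V : normedModType R}
    (l : {linear U -> V}) (c : R -> U) (t : R) (dc : U) :
  continuous l -> is_derive t 1 c dc -> is_derive t 1 (l \o c) (l dc).
Proof.
move=> lc [dct dcE].
have dc' : differentiable c t by exact/derivable1_diffP.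
have dl : differentiable l (c t) by exact/linear_differentiable.
have dlc : differentiable (l \o c) t by exact: differentiable_comp.
apply: DeriveDef; first exact/derivable1_diffP.
by rewrite deriveE// diff_comp//= diff_lin// -deriveE// dcE.
Qed.

Lemma is_derive_scalel {R : realType} {V : normedModType R} (f : R -> R)
    (t df : R) (x : V) :
  is_derive t 1 f df -> is_derive t 1 (fun s => f s *: x) (df *: x).
Proof.
move=> [ft fE]; have dft : differentiable f t by exact/derivable1_diffP.
apply: DeriveDef; first exact/derivable1_diffP/differentiableZl.
rewrite deriveE; last exact: differentiableZl.
by rewrite diffZl// -deriveE// fE.
Qed.

Lemma is_derive_continuous {R : realType} {V : normedModType R} (f df : R -> V) :
  (forall t : R, is_derive t 1 f (df t)) -> continuous f.
Proof.
by move=> fd t; apply/differentiable_continuous/derivable1_diffP; case: (fd t).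
Qed.

Section Geodesics.
Context {R : realType} {d : nat}.
Local Notation V := 'rV[R]_(d.-1).
Local Notation W := (V * R)%type.
Implicit Types (c : R -> ambient R d) (p q : ambient R d) (s t : R).

(** This map turns the upper halfspace into the part of a vector space above a
    paraboloid. It is the upper halfspace version of the passage to the Klein
    model, in which geodesics are chords. *)
Definition paraboloid_map p : W := (p.1, sqnorm p.1 + p.2 ^+ 2).

Lemma is_derive_snd c t (dc : W) :
  is_derive t 1 c dc -> is_derive t 1 (fun s => (c s).2) dc.2.
Proof.
move=> cd; apply: (@is_derive_linear_comp _ _ _ (@snd V R)) => //.
by move=> x; exact: cvg_snd.
Qed.

Lemma is_derive_coord c t (dc : W) j :
  is_derive t 1 c dc -> is_derive t 1 (fun s => (c s).1 0 j) (dc.1 0 j).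
Proof.
move=> cd.
have [cd1 cdE] : is_derive t 1 (fst \o c) dc.1.
  apply: (@is_derive_linear_comp _ _ _ (@fst V R)) => //.
  by move=> x; exact: cvg_fst.
apply: DeriveDef; first exact: ((derivable_mxP _ _ _).1 cd1).
by rewrite -cdE derive_mx// mxE.
Qed.

Lemma is_derive_curve (sg y : R -> R) (dsg dy : R) (v D : V) t :
  is_derive t 1 sg dsg -> is_derive t 1 y dy ->
  is_derive t 1 (fun s => (v + sg s *: D, y s) : W) (dsg *: D, dy).
Proof.
move=> dsgt dyt.
have H1 := @is_derive_scalel _ W _ _ _ (D, 0) dsgt.
have H2 := @is_derive_scalel _ W _ _ _ (0, 1) dyt.
have H := is_deriveD (is_derive_cst ((v, 0) : W) t 1) (is_deriveD H1 H2).
have -> : (fun s => (v + sg s *: D, y s) : W) =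
   cst (v, 0) + ((fun s => sg s *: ((D, 0) : W)) + (fun s => y s *: ((0, 1) : W))).
  apply/funext => s; congr pair => /=; first by rewrite scaler0 addr0.
  by rewrite scaler0 add0r add0r scale_realE mulr1.
apply: is_derive_eq H _; rewrite add0r; congr pair => /=.
  by rewrite scaler0 addr0.
by rewrite scaler0 add0r scale_realE mulr1.
Qed.

(** The equation [g' = 2 * y' / y * g] says that [g] and [y ^+ 2] have the same
    logarithmic derivative. *)
Lemma proportional_to_sqr (g y dy : R -> R) :
  (forall t, 0 < y t) ->
  (forall t, is_derive t 1 g (2 * dy t / y t * g t)) ->
  (forall t, is_derive t 1 y (dy t)) ->
  exists k, forall t, g t = k * y t ^+ 2.
Proof.
move=> y0 dgt dyt; exists (g 0 * (y 0)^-1 ^+ 2) => t.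
suff -> : g 0 * (y 0)^-1 ^+ 2 = g t * (y t)^-1 ^+ 2.
  by rewrite -mulrA -exprMn mulVf ?expr1n ?mulr1// gt_eqF.
have dV s : is_derive s 1 (fun r => (y r)^-1) (- (y s) ^- 2 * dy s).
  by have := @is_deriveV _ y s (dy s) 1 (lt0r_neq0 (y0 s)) (dyt s).
apply: (@is_derive_0_is_cst _ (fun r => g r * (y r)^-1 ^+ 2)) => s.
have := is_deriveM (dgt s) (is_deriveM (dV s) (dV s)).
move=> H; apply: is_derive_eq; rewrite !fctE /= !scale_realE.
by field; rewrite gt_eqF.
Qed.

(** The horizontal part of the geodesic equation is [v'' = (2 y' / y) v']. Both parts
    together give the same equation for the derivative of [|v|^2 + y^2]. So the
    velocity of the image curve is [y ^+ 2] times a constant vector. *)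
Lemma geodesic_chord_velocity c : geodesic c -> exists w : W,
  (forall j t, is_derive t 1 (fun s => (c s).1 0 j) (w.1 0 j * (c t).2 ^+ 2)) /\
  (forall t, is_derive t 1 (fun s => (paraboloid_map (c s)).2)
     (w.2 * (c t).2 ^+ 2)).
Proof.
move=> [c0 cd eq1 eq2].
have cD t : is_derive t 1 c (c^`() t).
  by have [cdt _] := cd t; rewrite derive1E; exact: derivableP.
have c'D t : is_derive t 1 c^`() (c^`()^`() t).
  by have [_ cdt] := cd t; rewrite [_^`() t]derive1E; exact: derivableP.
pose y t := (c t).2; pose dy t := (c^`() t).2.
have yD t : is_derive t 1 y (dy t) := is_derive_snd (cD t).
have dyD t : is_derive t 1 dy ((dy t ^+ 2 - sqnorm (c^`() t).1) / y t).
  exact: is_derive_eq (is_derive_snd (c'D t)) (eq2 t).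
have vD j t : is_derive t 1 (fun s => (c s).1 0 j) ((c^`() t).1 0 j).
  exact: is_derive_coord.
have dvD j t : is_derive t 1 (fun s => (c^`() s).1 0 j)
    (2 * dy t / y t * (c^`() t).1 0 j).
  apply: is_derive_eq (is_derive_coord j (c'D t)) _.
  by have /rowP/(_ j) := eq1 t; rewrite mxE.
have /choice[w1 Hw1] : forall j, exists k, forall t, (c^`() t).1 0 j = k * y t ^+ 2.
  by move=> j; exact: (proportional_to_sqr c0 (dvD j) yD).
pose g t := 2 * (dotp (c t).1 (c^`() t).1 + y t * dy t).
have hD t : is_derive t 1 (fun s => (paraboloid_map (c s)).2) (g t).
  have := is_deriveD (is_derive_sum (fun j => is_deriveX 2 (vD j t)))
    (is_deriveX 2 (yD t)).
  rewrite (_ : _ + _ = (fun s => (paraboloid_map (c s)).2)); last first.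
    by apply/funext => s; rewrite /paraboloid_map/= /sqnorm /GRing.add/= fct_sumE.
  move=> H; apply: is_derive_eq H _; rewrite /g /dotp mulrDr mulr_sumr.
  rewrite !scale_realE expr1 mulrA; congr (_ + _).
  by apply: eq_bigr => j _; rewrite !scale_realE expr1 mulrA.
have gD t : is_derive t 1 g (2 * dy t / y t * g t).
  have gE : g = 2 *: ((\sum_j ((fun s => (c s).1 0 j) * (fun s => (derive1 c s).1 0 j))) +
      y * dy).
    by apply/funext => s; rewrite /g /dotp !fctE fct_sumE.
  have H := is_deriveZ 2 (is_deriveD
    (is_derive_sum (fun j => is_deriveM (vD j t) (dvD j t)))
    (is_deriveM (yD t) (dyD t))).
  rewrite {1}gE; apply: is_derive_eq H _; rewrite /g !scale_realE.
  under eq_bigr do rewrite !scale_realE.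
  rewrite big_split/=.
  have -> : \sum_j (c t).1 0 j * (2 * dy t / y t * (derive1 c t).1 0 j) =
      2 * dy t / y t * dotp (c t).1 (derive1 c t).1.
    by rewrite /dotp mulr_sumr; apply: eq_bigr => j _; ring.
  have -> : \sum_j (derive1 c t).1 0 j * (derive1 c t).1 0 j = sqnorm (derive1 c t).1.
    by rewrite /sqnorm; apply: eq_bigr.
  by field; rewrite gt_eqF//; exact: c0.
have [k Hk] := proportional_to_sqr c0 gD yD.
exists (\row_j w1 j, k); split => [j t|t]; last by rewrite -Hk; exact: hD.
by rewrite mxE -Hw1; exact: vD.
Qed.

(** If the constant vector [w] is not zero, [s] is read off from a coordinate in which
    it does not vanish; its derivative [y ^+ 2] is positive. *)
Lemma geodesic_chord c : geodesic c -> exists w : W, exists s : R -> R,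
  [/\ s 0 = 0, {homo s : t u / t < u}, continuous s &
      forall t, paraboloid_map (c t) = paraboloid_map (c 0) + s t *: w].
Proof.
move=> gc; have [w [w1 w2]] := geodesic_chord_velocity gc; have [c0 _ _ _] := gc.
have step f k : k != 0 -> (forall t, is_derive t 1 f (k * (c t).2 ^+ 2)) ->
  exists s : R -> R, [/\ s 0 = 0, {homo s : t u / t < u}, continuous s &
      forall t, is_derive t 1 s ((c t).2 ^+ 2)].
  move=> k0 fD; pose s t := k^-1 * (f t - f 0).
  have sD t : is_derive t 1 s ((c t).2 ^+ 2).
    have H := is_deriveZ k^-1 (is_deriveB (fD t) (is_derive_cst (f 0) t 1)).
    by apply: is_derive_eq H _; rewrite subr0 scale_realE mulKf.
  have sc := is_derive_continuous sD.
  exists s; split => //; first by rewrite /s subrr mulr0.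
  move=> t u tu; apply: (@gtr0_derive1_incr _ s t u) => //.
  - by move=> x _; rewrite derive1E; have [_ ->] := sD x; apply: exprn_gt0; exact: c0.
  - by apply: continuous_subspaceT => x; exact: sc.
have finish (s : R -> R) : s 0 = 0 -> (forall t, is_derive t 1 s ((c t).2 ^+ 2)) ->
    forall t, paraboloid_map (c t) = paraboloid_map (c 0) + s t *: w.
  move=> s0 sD t.
  have cst f k : (forall t, is_derive t 1 f (k * (c t).2 ^+ 2)) ->
      f t = f 0 + s t * k.
    move=> fD.
    have H (r : R) : is_derive r 1 (fun r => f r - k * s r) 0.
      have H := is_deriveB (fD r) (is_deriveZ k (sD r)).
      by apply: is_derive_eq H _; rewrite scale_realE subrr.
    have := is_derive_0_is_cst t 0 H; rewrite s0 mulr0 subr0 => <-.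
    by rewrite mulrC subrK.
  apply: injective_projections => /=; last exact: cst w2.
  by apply/rowP => j; rewrite !mxE; exact: cst (w1 j).
have [wj|] := pselect (exists j, w.1 0 j != 0).
  have [j wj0] := wj; have [s [s0 sh sc sD]] := step _ _ wj0 (w1 j).
  by exists w, s; split => //; exact: finish.
move=> /forallNP w10.
have [w20|w20] := eqVneq w.2 0; last first.
  have [s [s0 sh sc sD]] := step _ _ w20 w2.
  by exists w, s; split => //; exact: finish.
exists 0, id; split => // t; first exact: cvg_id.
rewrite scaler0 addr0.
have cst f k : k = 0 -> (forall t, is_derive t 1 f (k * (c t).2 ^+ 2)) -> f t = f 0.
  move=> -> fD; apply: is_derive_0_is_cst => r.
  by have := fD r; rewrite mul0r.
apply: injective_projections; last exact: cst w20 w2.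
apply/rowP => j; apply: (cst _ _ _ (w1 j)).
by apply/eqP; have := w10 j; move=> /negP; rewrite negbK.
Qed.

End Geodesics.

Section GeodesicExistence.
Context {R : realType} {d : nat}.
Local Notation V := 'rV[R]_(d.-1).
Local Notation W := (V * R)%type.
Implicit Types (c : R -> ambient R d) (p q : ambient R d) (s t : R).

Lemma derive1_curve (sg y dsg dy : R -> R) (v D : V) :
  (forall t : R, is_derive t 1 sg (dsg t)) -> (forall t : R, is_derive t 1 y (dy t)) ->
  derive1 (fun s => (v + sg s *: D, y s) : W) = (fun t => (dsg t *: D, dy t)).
Proof.
move=> dsgt dyt; apply/funext => t; rewrite derive1E.
by have [_ ->] := is_derive_curve v D (dsgt t) (dyt t).
Qed.

Lemma geodesic_cst p : 0 < p.2 -> geodesic (cst p).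
Proof.
move=> p0.
have cst' (q : ambient R d) : derive1 (cst q : R -> ambient R d) = cst 0.
  by apply/funext => t; rewrite derive1E derive_cst.
split => t; rewrite ?cst' //=.
- exact/esym/scaler0.
- rewrite /sqnorm big1 ?subr0 ?expr0n/= ?mul0r// => j _.
  by rewrite mxE expr0n.
Qed.

(** The first component of a point [(v, y)] in the hyperboloid model is [1 / y]
    up to normalisation, and hyperboloid geodesics are combinations of
    [exp (L t)] and [exp (- L t)], where [L] is the distance of the endpoints. This
    gives the formulas below for [u = 1 / y] and for the weight [sg] of the endpoint
    [q], both for semicircles and for vertical lines. *)
Lemma geodesic_exists p q : 0 < p.2 -> 0 < q.2 ->
  exists c, [/\ geodesic c, c 0 = p & c 1 = q].
Proof.
move: p q => [v x] [w z] /= x0 z0.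
have [[<- <-]|pq] := eqVneq (v, x) (w, z).
  by exists (cst (v, x)); split => //; exact: geodesic_cst.
pose N := sqnorm (w - v).
have N0 : 0 <= N := sqnorm_ge0 _.
have Nxz : 0 < N + (x - z) ^+ 2.
  rewrite lt_def addr_ge0 ?sqr_ge0// andbT; apply: contra_neq pq.
  move/eqP; rewrite paddr_eq0 ?sqr_ge0// sqrf_eq0 subr_eq0 => /andP[N_eq0 /eqP ->].
  congr pair; apply/eqP; rewrite eq_sym -subr_eq0 -normr_eq0 -sqrf_eq0.
  by rewrite eq_le sqr_ge0 andbT (le_trans (sqr_norm_le_sqnorm _))// -/N (eqP N_eq0).
(* [C] is the hyperbolic cosine of the distance, and [E] the exponential of the
   distance. *)
pose C := (N + x ^+ 2 + z ^+ 2) / (2 * x * z).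
have xz0 : 0 < 2 * x * z by rewrite !mulr_gt0.
have CE : C * (2 * x * z) = N + x ^+ 2 + z ^+ 2 by rewrite /C divfK// gt_eqF.
have C1 : 1 < C.
  by rewrite /C ltr_pdivlMr// mul1r; move: Nxz; rewrite sqrrB; lra.
pose r := Num.sqrt (C ^+ 2 - 1).
have r2 : r ^+ 2 = C ^+ 2 - 1 by rewrite sqr_sqrtr//; nra.
have r0 : 0 <= r := sqrtr_ge0 _.
pose E := C + r.
have E1 : 1 < E by rewrite /E; lra.
have E0 : 0 < E by lra.
have EE : E ^+ 2 + 1 = 2 * C * E by rewrite /E; nra.
have EV : E^-1 = 2 * C - E.
  apply: (mulfI (lt0r_neq0 E0)); rewrite divff ?gt_eqF//.
  by move: EE; rewrite expr2; lra.
pose S := E - E^-1.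
have S0 : 0 < S.
  by rewrite /S subr_gt0 (lt_trans _ E1)// invf_lt1.
have prod_ge0 : 0 <= (x * E - z) * (z * E - x).
  have -> : (x * E - z) * (z * E - x) = x * z * (E ^+ 2 + 1) - (x ^+ 2 + z ^+ 2) * E.
    by ring.
  rewrite EE (_ : _ - _ = (C * (2 * x * z) - (x ^+ 2 + z ^+ 2)) * E); last by ring.
  by rewrite CE; apply: mulr_ge0; [lra|exact: ltW].
have [xE zE] : x < x * E /\ z < z * E by split; rewrite ltr_pMr.
have Exz : z <= x * E.
  rewrite leNgt; apply/negP => h; move: prod_ge0; rewrite leNgt => /negP; apply.
  by rewrite nmulr_rlt0; lra.
have Ezx : x <= z * E.
  rewrite leNgt; apply/negP => h; move: prod_ge0; rewrite leNgt => /negP; apply.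
  by rewrite nmulr_llt0; lra.
pose L := ln E.
have LE : expR L = E by rewrite lnK// posrE.
pose a t := expR (L * t); pose b t := expR (- L * t).
have ab t : a t * b t = 1 by rewrite -expRD mulNr subrr expR0.
have aD (t : R) : is_derive t 1 a (L * a t).
  have := is_derive1_comp (is_derive_expR (L * t)) (is_deriveZ L (is_derive_id t 1)).
  by move=> H; apply: is_derive_eq H _; rewrite scale_realE mulr1 mulrC.
have bD (t : R) : is_derive t 1 b (- L * b t).
  have := is_derive1_comp (is_derive_expR (- L * t)) (is_deriveZ (- L) (is_derive_id t 1)).
  by move=> H; apply: is_derive_eq H _; rewrite scale_realE mulr1 mulrC.
have a0 t : 0 < a t := expR_gt0 _.
have b0 t : 0 < b t := expR_gt0 _.
(* These coefficients give [u] the values [1 / x] at 0 and [1 / z] at 1. *)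
pose A := (z^-1 - (x * E)^-1) / S; pose B := (E / x - z^-1) / S.
have A0 : 0 <= A.
  by rewrite divr_ge0 ?(ltW S0)// subr_ge0 lef_pV2// posrE mulr_gt0.
have B0 : 0 <= B.
  rewrite divr_ge0 ?(ltW S0)// subr_ge0 -[X in X <= _]mul1r.
  by rewrite ler_pdivrMr// mulrAC ler_pdivlMr// mul1r mulrC.
have ABx : A + B = x^-1.
  by rewrite /A /B /S; field; rewrite !gt_eqF//=; move: S0; rewrite /S; nra.
pose u t := A * a t + B * b t.
have AB0 : 0 < A + B by rewrite ABx invr_gt0.
have u0 t : 0 < u t.
  rewrite /u; have [A_eq0|A_neq0] := eqVneq A 0.
    by rewrite A_eq0 mul0r add0r mulr_gt0//; lra.
  apply: ltr_pwDl; first by apply: mulr_gt0 => //; rewrite lt_def A_neq0.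
  by apply: mulr_ge0 => //; exact: ltW.
pose du t := L * (A * a t - B * b t).
have uD (t : R) : is_derive t 1 u (du t).
  have H := is_deriveD (is_deriveZ A (aD t)) (is_deriveZ B (bD t)).
  by apply: is_derive_eq H _; rewrite /du !scale_realE; ring.
have duD (t : R) : is_derive t 1 du (L ^+ 2 * u t).
  have H := is_deriveZ L (is_deriveB (is_deriveZ A (aD t)) (is_deriveZ B (bD t))).
  by apply: is_derive_eq H _; rewrite /u !scale_realE; ring.
pose G := (z * S)^-1; pose k := 2 * G * L / x.
pose sg t := G * (a t - b t) / u t; pose y t := (u t)^-1.
have yD (t : R) : is_derive t 1 y (- du t * y t ^+ 2).
  have H := is_deriveV (lt0r_neq0 (u0 t)) (uD t).
  apply: is_derive_eq H _; rewrite scale_realE /y exprVn; ring.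
have sgD (t : R) : is_derive t 1 sg (k * y t ^+ 2).
  have H := is_deriveM (is_deriveZ G (is_deriveB (aD t) (bD t))) (yD t).
  apply: is_derive_eq H _; rewrite /k -ABx !fctE /= !scale_realE /y /du.
  have -> : 2 * G * L * (A + B) = 2 * G * L * (A + B) * (a t * b t).
    by rewrite ab mulr1.
  by move: (u0 t); rewrite /u => ut0; field; rewrite gt_eqF.
pose D := w - v.
pose c t : ambient R d := (v + sg t *: D, y t).
have c'E : derive1 c = (fun t => (0 + (k * y t ^+ 2) *: D, - du t * y t ^+ 2)).
  by rewrite (derive1_curve _ _ sgD yD); apply/funext => t; rewrite add0r.
have y2D (t : R) : is_derive t 1 (fun t => k * y t ^+ 2)
    (k * (2 * y t * (- du t * y t ^+ 2))).
  have H := is_deriveZ k (is_deriveX 2 (yD t)).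
  by apply: is_derive_eq H _; rewrite !scale_realE expr1; ring.
have dyD (t : R) : is_derive t 1 (fun t => - du t * y t ^+ 2)
    (- (L ^+ 2 * u t) * y t ^+ 2 + - du t * (2 * y t * (- du t * y t ^+ 2))).
  have H := is_deriveM (is_deriveN (duD t)) (is_deriveX 2 (yD t)).
  by apply: is_derive_eq H _; rewrite !fctE !scale_realE expr1; ring.
have c''E : derive1 (derive1 c) = (fun t => ((k * (2 * y t * (- du t * y t ^+ 2))) *: D,
    - (L ^+ 2 * u t) * y t ^+ 2 + - du t * (2 * y t * (- du t * y t ^+ 2)))).
  by rewrite c'E (derive1_curve _ _ y2D dyD).
have y0 t : 0 < y t by rewrite invr_gt0.
have sqnormZ l : sqnorm (l *: D) = l ^+ 2 * N.
  by rewrite /sqnorm mulr_sumr; apply: eq_bigr => j _; rewrite mxE exprMn.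
have k2N : k ^+ 2 * N = 4 * A * B * L ^+ 2.
  have -> : N = C * (2 * x * z) - x ^+ 2 - z ^+ 2 by rewrite CE; ring.
  have -> : C = (E + E^-1) / 2 by rewrite EV; field.
  rewrite /k /G /A /B; move: S0 => /lt0r_neq0; move: (S) => S' S'0.
  by field; do !(apply/andP; split) => //; rewrite gt_eqF.
(* Conservation of the speed, which is what the second component of the geodesic
   equation amounts to. *)
have energy t : du t ^+ 2 + k ^+ 2 * N = L ^+ 2 * u t ^+ 2.
  rewrite k2N (_ : 4 * A * B * L ^+ 2 = 4 * A * B * L ^+ 2 * (a t * b t)).
    by rewrite /du /u; ring.
  by rewrite ab mulr1.
have aE0 : a 0 = 1 by rewrite /a mulr0 expR0.
have bE0 : b 0 = 1 by rewrite /b mulr0 expR0.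
have aE1 : a 1 = E by rewrite /a mulr1.
have bE1 : b 1 = E^-1 by rewrite /b mulr1 expRN LE.
have u1 : u 1 = z^-1.
  rewrite /u aE1 bE1 /A /B; have := lt0r_neq0 S0; rewrite /S => S'0.
  by field; rewrite !gt_eqF//=; move: S0; rewrite /S; nra.
exists c; split.
- split => t.
  + exact: y0.
  + split; first by case: (is_derive_curve v D (sgD t) (yD t)).
    by rewrite c'E; case: (is_derive_curve 0 D (y2D t) (dyD t)).
  + rewrite c''E c'E /= add0r scalerA; congr (_ *: _).
    by rewrite -/(y t); field; rewrite gt_eqF.
  + rewrite c''E c'E /= add0r sqnormZ.
    have -> : (k * y t ^+ 2) ^+ 2 * N = y t ^+ 4 * (k ^+ 2 * N) by ring.
    have -> : k ^+ 2 * N = L ^+ 2 * u t ^+ 2 - du t ^+ 2 by rewrite -energy; ring.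
    by rewrite /y; field; rewrite gt_eqF.
- rewrite /c /sg /y /u aE0 bE0 subrr mulr0 mul0r scale0r addr0 !mulr1 ABx.
  by rewrite invrK.
- rewrite /c /y u1 invrK /sg u1 aE1 bE1 -/S invrK /G.
  have -> : (z * S)^-1 * S * z = 1 by field; rewrite !gt_eqF.
  by rewrite scale1r /D addrC subrK.
Qed.

End GeodesicExistence.

(** * From hyperbolic to linear convexity *)

Section ChordMap.
Context {R : realType} {d : nat}.
Local Notation V := 'rV[R]_(d.-1).
Local Notation W := (V * R)%type.
Local Notation H := (hyp R d).
Implicit Types (p q z : H) (A F X : set H) (s t : R).

Definition chord_map p : W := paraboloid_map (\val p).

Lemma hyp_gt0 p : 0 < (\val p).2.
Proof. by case: p => p hp; exact: set_mem hp. Qed.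

Lemma chord_map_above p : sqnorm (chord_map p).1 < (chord_map p).2.
Proof. by rewrite /= ltrDl exprn_gt0// hyp_gt0. Qed.

Lemma chord_map_inj : injective chord_map.
Proof.
move=> p q [] e1; rewrite e1 => /addrI e2; apply/val_inj.
apply: injective_projections => //.
by apply/eqP; rewrite -(eqrXn2 (n := 2))// ?ltW ?hyp_gt0//; apply/eqP.
Qed.

Lemma chord_map_surj (z : W) : sqnorm z.1 < z.2 -> exists p, chord_map p = z.
Proof.
move=> hz; have y0 : 0 < Num.sqrt (z.2 - sqnorm z.1) by rewrite sqrtr_gt0 subr_gt0.
exists (exist _ (z.1, Num.sqrt (z.2 - sqnorm z.1)) (mem_set y0)).
rewrite /chord_map /paraboloid_map /= sqr_sqrtr; last by rewrite subr_ge0 ltW.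
by rewrite addrC subrK -surjective_pairing.
Qed.

Lemma chord_comb_above p q t : 0 <= t <= 1 ->
  exists z, chord_map z = (1 - t) *: chord_map p + t *: chord_map q.
Proof.
move=> t01; apply: chord_map_surj.
by apply: (strictly_above_paraboloid_convex _ _ t01); exact: chord_map_above.
Qed.

Lemma segment_chord p q t z : segment_point p q t z -> 0 <= t <= 1 ->
  exists s, [/\ 0 <= s <= 1, 0 < t < 1 -> 0 < s < 1 &
    chord_map z = (1 - s) *: chord_map p + s *: chord_map q].
Proof.
move=> [c [gc c0 c1 ct]] /andP[t0 t1].
have [w [s [s0 sh sc sE]]] := geodesic_chord gc.
have s1 : 0 < s 1 by rewrite -s0; exact/sh/ltr01.
have smono : {homo s : t u / t <= u}.
  by move=> u v; rewrite le_eqVlt => /predU1P[->//|/sh/ltW].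
exists (s t / s 1); split.
- by rewrite ler_pdivrMr// mul1r smono// andbT divr_ge0 ?(ltW s1)// -s0 smono.
- move=> /andP[t0' t1']; rewrite ltr_pdivrMr// mul1r sh// andbT.
  by rewrite divr_gt0// -s0 sh.
- have := sE t; have := sE 1; rewrite /chord_map -ct -c0 -c1 => -> ->.
  rewrite scalerDr addrA -scalerDl subrK scale1r scalerA divfK//.
  by rewrite gt_eqF.
Qed.

Lemma chord_segment p q s z : 0 <= s <= 1 ->
  chord_map z = (1 - s) *: chord_map p + s *: chord_map q ->
  exists t, [/\ 0 <= t <= 1, 0 < s < 1 -> 0 < t < 1 & segment_point p q t z].
Proof.
move=> /andP[s0 s1] zE.
have [c [gc c0 c1]] := geodesic_exists (hyp_gt0 p) (hyp_gt0 q).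
have [w [f [f0 fh fc fE]]] := geodesic_chord gc.
have f1 : 0 < f 1 by rewrite -f0; exact/fh/ltr01.
have [||t] := @IVT _ f 0 1 (s * f 1) ler01.
- by apply: continuous_subspaceT => x; exact: fc.
- rewrite f0 (min_idPl (ltW f1)) (max_idPr (ltW f1)).
  by rewrite mulr_ge0 ?(ltW f1)//= ger_pMl.
rewrite in_itv/= => /andP[t0 t1] ft; exists t; split.
- by rewrite t0.
- move=> /andP[s0' s1']; apply/andP; split.
    rewrite lt_def t0 andbT; apply/eqP => tE; move: ft; rewrite tE f0.
    by move=> /esym/eqP; rewrite mulf_eq0 !gt_eqF.
  rewrite lt_def t1 andbT; apply/eqP => tE; move: ft; rewrite -tE => /eqP.
  by rewrite -{1}[f 1]mul1r -subr_eq0 -mulrBl mulf_eq0 !gt_eqF// subr_gt0.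
have gt0 : 0 < (c t).2 by case: gc.
have ctE : paraboloid_map (c t) = chord_map z.
  have := fE t; have := fE 1; rewrite c0 c1 ft zE /chord_map => -> ->.
  by rewrite scalerDr addrA -scalerDl subrK scale1r scalerA.
exists c; split => //.
by rewrite -(@chord_map_inj (exist _ (c t) (mem_set gt0)) z).
Qed.

Lemma image_chord_map A p : (chord_map @` A) (chord_map p) <-> A p.
Proof. by split=> [[q Aq /chord_map_inj <-]//|Ap]; exists p. Qed.

(** Geodesic segments and chords correspond as sets; only their
    parametrisations differ, by an increasing function. *)
Lemma geodesically_convexP A :
  geodesically_convex A <-> convex (chord_map @` A).
Proof.
split=> [gA _ _ s [p Ap <-] [q Aq <-] s01|cA p q t z Ap Aq t01 pqz].
  have [z zE] := chord_comb_above p q s01.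
  have [t [t01 _ pqz]] := chord_segment s01 zE.
  by rewrite -zE; exists z => //; exact: gA pqz.
have [s [s01 _ zE]] := segment_chord pqz t01.
by apply/image_chord_map; rewrite zE; apply: cA => //; exact/image_chord_map.
Qed.

Lemma faceP A F : face A F <-> cface (chord_map @` A) (chord_map @` F).
Proof.
split=> [[F0 FA /geodesically_convexP cF extr]|[F0 FA /geodesically_convexP cF extr]].
  split => //.
  - by have [p Fp] := F0; exists (chord_map p); exists p.
  - by move=> _ [p Fp <-]; exists p => //; exact: FA.
  - move=> _ _ s [p Ap <-] [q Aq <-] s01 [z Fz zE].
    have /andP[s0 s1] := s01.
    have s01' : 0 <= s <= 1 by rewrite !ltW.
    have [t [_ /(_ s01) t01 pqz]] := chord_segment s01' zE.
    by have [Fp Fq] := extr p q t z Ap Aq t01 pqz Fz; split; apply/image_chord_map.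
split => //.
- by have [_ [p Fp _]] := F0; exists p.
- by move=> p /image_chord_map/FA/image_chord_map.
- move=> p q t z Ap Aq t01 pqz Fz; have /andP[t0 t1] := t01.
  have [|s [_ /(_ t01) s01 zE]] := segment_chord pqz; first by rewrite !ltW.
  have [] := extr _ _ s ((image_chord_map A p).2 Ap) ((image_chord_map A q).2 Aq) s01.
    by rewrite -zE; apply/image_chord_map.
  by move=> /image_chord_map Fp /image_chord_map Fq.
Qed.

Lemma hyp_conv_convex X : geodesically_convex (hyp_conv X).
Proof.
move=> p q t z Xp Xq t01 pqz A AX; have [gA XA] := AX.
exact: gA (Xp A AX) (Xq A AX) t01 pqz.
Qed.

Lemma sub_hyp_conv X : X `<=` hyp_conv X.
Proof. by move=> p Xp A [_]; apply. Qed.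

Lemma chord_map_hull X : chord_map @` hyp_conv X = chull (chord_map @` X).
Proof.
apply/seteqP; split; last first.
  apply: chull_sub; first exact: ((geodesically_convexP _).1 (@hyp_conv_convex X)).
  by move=> _ [p Xp <-]; exists p => //; exact: (sub_hyp_conv Xp).
have above : chull (chord_map @` X) `<=` [set z : W | sqnorm z.1 < z.2].
  apply: chull_sub; first exact: strictly_above_paraboloid_convex.
  by move=> _ [p _ <-]; exact: chord_map_above.
move=> _ [p Xp <-]; apply: (Xp [set p | chull (chord_map @` X) (chord_map p)]).
split; last by move=> q Xq; apply: sub_chull; exists q.
move=> q q' t z /= Xq Xq' t01 qz.
have [s [s01 _ ->]] := segment_chord qz t01.
exact: chull_convex.
Qed.

Lemma geodesically_convex_connected A : geodesically_convex A -> connected A.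
Proof.
move=> gA; have [->|/set0P[a Aa]] := eqVneq A set0; first exact: connected0.
suff -> : A = connected_component A a by exact: component_connected.
apply/seteqP; split; last exact: connected_component_sub.
move=> q Aq; have [c [gc c0 c1]] := geodesic_exists (hyp_gt0 a) (hyp_gt0 q).
have [cpos cd _ _] := gc.
pose g (t : R) : H := exist _ (c t) (mem_set (cpos t)).
have cc : continuous c.
  move=> t; have [cdt _] := cd t.
  exact/differentiable_continuous/derivable1_diffP.
have g0 : g 0 = a by apply/val_inj => /=; exact: c0.
have g1 : g 1 = q by apply/val_inj => /=; exact: c1.
have gcont : continuous g by move=> t; apply: continuous_comp_initial; exact: cc.
apply: (@connected_component_max _ _ (g @` `[0, 1])).
- by exists 0 => //=; rewrite in_itv/= lexx ler01.
- move=> _ [t /= + <-]; rewrite in_itv/= => t01.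
  apply: (gA _ _ _ _ Aa Aq t01); exists c.
  by [].
- apply: connected_continuous_connected; first exact: segment_connected.
  by apply: continuous_subspaceT => x; exact: gcont.
- by exists 1 => //=; rewrite in_itv/= lexx ler01.
Qed.

End ChordMap.

(** * Totally geodesic hypersurfaces *)

Section Hypersurfaces.
Context {R : realType} {d : nat}.
Local Notation V := 'rV[R]_(d.-1).
Local Notation W := (V * R)%type.
Local Notation H := (hyp R d).
Implicit Types (p q z : H) (a : V) (b s t : R).

(** The zero sets are preimages of non-vertical hyperplanes. Completing the square,
    they are the hemispheres with centre [(a / 2, 0)] and squared radius
    [b + |a|^2 / 4] if this is positive, and empty otherwise. *)
Definition sphere_fun a b (p : ambient R d) : R :=
  (paraboloid_map p).2 - dotp a (paraboloid_map p).1 - b.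

Lemma is_derive_linear {U U' : normedModType R} (l : {linear U -> U'}) (q u : U) :
  continuous l -> is_derive q u l (l u).
Proof.
move=> lc; have dl : differentiable l q by exact: linear_differentiable.
by apply: DeriveDef; [exact: diff_derivable|rewrite deriveE// diff_lin].
Qed.

Lemma is_derive_coord_dir (q u : W) j : is_derive q u (fun x : W => x.1 0 j) (u.1 0 j).
Proof.
have [d1 dE] : is_derive q u (@fst V R) u.1.
  by apply: (@is_derive_linear _ _ (@fst V R)) => x; exact: cvg_fst.
apply: DeriveDef; first exact: ((derivable_mxP _ _ _).1 d1).
by have := dE; rewrite derive_mx// => /rowP/(_ j); rewrite mxE.
Qed.

Lemma sphere_funE a b : sphere_fun a b =
  \sum_j ((fun p : W => p.1 0 j) ^+ 2) + (@snd V R) ^+ 2 -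
  \sum_j (a 0 j *: (fun p : W => p.1 0 j)) - cst b.
Proof.
by apply/funext => p; rewrite /sphere_fun /paraboloid_map /sqnorm /dotp/= !fctE !fct_sumE.
Qed.

Lemma is_derive_sphere_fun a b (q u : W) :
  is_derive q u (sphere_fun a b) (2 * dotp q.1 u.1 + 2 * q.2 * u.2 - dotp a u.1).
Proof.
rewrite sphere_funE.
have d2 : is_derive q u (@snd V R) u.2.
  by apply: (@is_derive_linear _ _ (@snd V R)) => x; exact: cvg_snd.
have HD := is_deriveB (is_deriveB (is_deriveD
    (is_derive_sum (fun j => is_deriveX 2 (is_derive_coord_dir q u j)))
    (is_deriveX 2 d2))
  (is_derive_sum (fun j => is_deriveZ (a 0 j) (is_derive_coord_dir q u j))))
  (is_derive_cst b q u).
apply: is_derive_eq HD _; rewrite subr0 /dotp mulr_sumr; congr (_ + _ - _).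
by apply: eq_bigr => j _; rewrite !scale_realE expr1 mulrA.
Qed.

Lemma differentiable_coord_fst (q : W) j : differentiable (fun x : W => x.1 0 j) q.
Proof.
apply: (@differentiable_comp _ _ _ _ (@fst V R) (fun v : V => v 0 j)).
  by apply: linear_differentiable => x; exact: cvg_fst.
exact: differentiable_coord.
Qed.

Lemma differentiable_snd (q : W) : differentiable (@snd V R) q.
Proof. by apply: linear_differentiable => x; exact: cvg_snd. Qed.

Lemma differentiable_sphere_fun a b (q : W) : differentiable (sphere_fun a b) q.
Proof.
rewrite sphere_funE; apply: differentiableB; last exact: differentiable_cst.
apply: differentiableB; last first.
  apply: differentiable_sum => j; apply: differentiableZ.
  exact: differentiable_coord_fst.
apply: differentiableD; last exact/differentiableX/differentiable_snd.
by apply: differentiable_sum => j; exact/differentiableX/differentiable_coord_fst.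
Qed.

Lemma continuous_sphere_fun a b : continuous (sphere_fun a b).
Proof. by move=> q; exact/differentiable_continuous/differentiable_sphere_fun. Qed.

Lemma continuous_derive_sphere_fun a b (u : W) :
  continuous (fun q : W => 'D_u (sphere_fun a b) q).
Proof.
have -> : (fun q : W => 'D_u (sphere_fun a b) q) =
    2 *: (\sum_j (u.1 0 j *: (fun p : W => p.1 0 j))) +
    (2 * u.2) *: (@snd V R) - cst (dotp a u.1).
  apply/funext => q; have [_ ->] := is_derive_sphere_fun a b q u.
  rewrite !fctE !fct_sumE /= !scale_realE /dotp; congr (2 * _ + _ - _).
    by apply: eq_bigr => j _; rewrite !fctE scale_realE mulrC.
  by rewrite mulrAC.
move=> q; apply: differentiable_continuous.
apply: differentiableB; last exact: differentiable_cst.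
apply: differentiableD; apply: differentiableZ; last exact: differentiable_snd.
by apply: differentiable_sum => j; exact/differentiableZ/differentiable_coord_fst.
Qed.

(** Along a geodesic the derivative of such a function is a constant multiple of the
    square of the height, so it vanishes identically once it vanishes at one time. *)
Lemma sphere_fun_tangent_geodesic a b c : geodesic c ->
  derive1 (sphere_fun a b \o c) 0 = 0 ->
  forall t, sphere_fun a b (c t) = sphere_fun a b (c 0).
Proof.
move=> gc; have [c0 _ _ _] := gc; have [w [w1 w2]] := geodesic_chord_velocity gc.
pose k := w.2 - dotp a w.1.
have fE : sphere_fun a b \o c = (fun s => (paraboloid_map (c s)).2) -
    \sum_j (a 0 j *: (fun s => (c s).1 0 j)) - cst b.
  by apply/funext => s; rewrite /sphere_fun /dotp /= !fctE !fct_sumE.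
have D t : is_derive t 1 (sphere_fun a b \o c) (k * (c t).2 ^+ 2).
  have HD := is_deriveB (is_deriveB (w2 t)
    (is_derive_sum (fun j => is_deriveZ (a 0 j) (w1 j t)))) (is_derive_cst b t 1).
  rewrite fE; apply: is_derive_eq HD _; rewrite subr0 /k mulrBl /dotp mulr_suml.
  congr (_ - _); apply: eq_bigr => j _; by rewrite scale_realE mulrA.
rewrite derive1E; have [_ ->] := D 0.
move=> /eqP; rewrite mulf_eq0 sqrf_eq0 (gt_eqF (c0 0)) orbF => /eqP k0 t.
apply: (@is_derive_0_is_cst _ (sphere_fun a b \o c)) => s.
by have := D s; rewrite k0 mul0r.
Qed.

Definition hemisphere a b : set H := [set p | sphere_fun a b (\val p) = 0].

Lemma sphere_fun_convex a b p q z s :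
  chord_map z = (1 - s) *: chord_map p + s *: chord_map q ->
  sphere_fun a b (\val z) =
  (1 - s) * sphere_fun a b (\val p) + s * sphere_fun a b (\val q).
Proof.
by rewrite /sphere_fun -!/(chord_map _) => ->; rewrite fst_comb snd_comb dotp_comb; ring.
Qed.

Lemma continuous_hyp_val : continuous (fun p : H => \val p).
Proof. exact: initial_continuous. Qed.

Lemma hemisphere_totally_geodesic a b :
  hemisphere a b !=set0 -> totally_geodesic_hypersurface (hemisphere a b).
Proof.
move=> S0; split => //.
- have fc : continuous (sphere_fun a b \o (fun p : H => \val p)).
    move=> p; apply: continuous_comp; first exact: continuous_hyp_val.
    exact: continuous_sphere_fun.
  exact: ((continuous_closedP _).1 fc _ (@closed_eq R 0)).
- apply: geodesically_convex_connected => p q t z Sp Sq t01 pqz.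
  have [s [_ _ /(sphere_fun_convex a b) zE]] := segment_chord pqz t01.
  by rewrite /hemisphere /= zE Sp Sq !mulr0 addr0.
- move=> p Sp; exists (sphere_fun a b); split.
  + apply: filterE => q; split; first exact: differentiable_sphere_fun.
    by move=> u; exact: continuous_derive_sphere_fun.
  + exists ((0, 1) : W); have [_ ->] := is_derive_sphere_fun a b (\val p) (0, 1).
    have dotp0 (v : V) : dotp v (0 : V) = 0.
      by rewrite /dotp big1// => j _; rewrite mxE mulr0.
    by rewrite /= !dotp0 mulr0 add0r subr0 mulr1 mulf_neq0// gt_eqF// hyp_gt0.
  + by apply: filterE => q.
  + move=> c gc cp /(sphere_fun_tangent_geodesic gc) cE t z cz.
    by rewrite /hemisphere /= -cz cE cp.
Qed.

(** The open side of a hemisphere is geodesically convex, hence connected. *)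
Lemma hemisphere_supports a b (A : set H) x : A x -> hemisphere a b x ->
  (forall q, A q -> 0 <= sphere_fun a b (\val q)) ->
  supports_at (hemisphere a b) A x.
Proof.
move=> Ax Sx A0; split => //; first by apply: hemisphere_totally_geodesic; exists x.
exists [set q | 0 < sphere_fun a b (\val q)]; split.
- apply: geodesically_convex_connected => p q t z /= p0 q0 t01 pqz.
  have [s [/andP[s0 s1] _ /(sphere_fun_convex a b) ->]] := segment_chord pqz t01.
  move: s0; rewrite le_eqVlt => /predU1P[<-|s0]; first by lra.
  by nra.
- by move=> q /= q0 Sq; move: q0; rewrite Sq ltxx.
- move=> q [Aq /= Sq]; rewrite lt_def A0// andbT.
  by apply/eqP.
Qed.

End Hypersurfaces.

(** * Unboundedness and ideal points *)

Section Distance.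
Context {R : realType} {d : nat}.
Local Notation H := (hyp R d).

(** The vertical speed [y' / y] is a lower bound for the hyperbolic speed, and it
    integrates to the logarithm of the ratio of the heights. *)
Lemma curve_length_ge (c : R -> ambient R d) : C1_curve c ->
  ((ln (c 1).2 - ln (c 0).2)%:E <= curve_length c)%E.
Proof.
move=> [c0 cd cc].
have cD (t : R) : is_derive t 1 c (derive1 c t).
  by have := cd t; rewrite derive1E => /derivableP.
pose y t := (c t).2; pose dy t := (derive1 c t).2.
have yD (t : R) : is_derive t 1 y (dy t) := is_derive_snd (cD t).
have yc : continuous y := is_derive_continuous yD.
have dyc : continuous dy.
  by move=> t; apply: continuous_comp; [exact: cc|exact: cvg_snd].
pose f t := dy t / y t.
have Vc : continuous (fun t => (y t)^-1).
  by move=> t; apply: continuousV; [rewrite gt_eqF//; exact: c0|exact: yc].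
have fc : continuous f.
  by move=> t; apply: cvgM; [exact: dyc|exact: Vc].
pose F t := ln (y t).
have FD (t : R) : is_derive t 1 F (f t).
  have HD := is_derive1_comp (is_derive1_ln (c0 t)) (yD t).
  by apply: is_derive_eq HD _; rewrite mulrC.
have Fc : continuous F := is_derive_continuous FD.
pose g t := Num.sqrt (metric_tensor (c t) (derive1 c t)).
have coordc j : continuous (fun t => (derive1 c t).1 0 j).
  move=> t; apply: (@continuous_comp _ _ _ (derive1 c) (fun p => p.1 0 j)).
    exact: cc.
  exact/differentiable_continuous/differentiable_coord_fst.
have gc : continuous g.
  pose e t := (\sum_j (derive1 c t).1 0 j * (derive1 c t).1 0 j + dy t * dy t) *
    ((y t)^-1 * (y t)^-1).
  have -> : g = Num.sqrt \o e.
    apply/funext => t; rewrite /g /metric_tensor /sqnorm /e /= -!expr2 exprVn.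
    by congr (Num.sqrt ((_ + _) * _)); apply: eq_bigr => j _; rewrite expr2.
  move=> t; apply: (@continuous_comp _ _ _ e); last exact: sqrt_continuous.
  apply: cvgM; last by apply: cvgM; exact: Vc.
  apply: cvgD; last by apply: cvgM; exact: dyc.
  pose sq j t := (derive1 c t).1 0 j * (derive1 c t).1 0 j : R.
  have sqE : (fun t => \sum_j sq j t) = \sum_j sq j by apply/funext => u; rewrite fct_sumE.
  have sumc : continuous (\sum_j sq j : R -> R).
    elim/big_ind : _ => [|h1 h2 h1c h2c|j _] u; first exact: cvg_cst.
      by apply: cvgD; [exact: h1c|exact: h2c].
    by apply: cvgM; exact: coordc.
  by have := sumc t; rewrite /continuous_at -sqE.
have itg (h : R -> R) : continuous h ->
    lebesgue_measure.-integrable `[0, 1] (EFin \o h).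
  move=> hc; apply: continuous_compact_integrable; first exact: segment_compact.
  exact: continuous_subspaceT.
have <- : (\int[lebesgue_measure]_(t in `[0%R, 1%R]) (f t)%:E =
    (ln (y 1) - ln (y 0))%:E)%E.
  rewrite (@continuous_FTC2 _ f F 0 1) ?EFinB//.
  - exact: continuous_subspaceT.
  - split.
    + by move=> t _; have [] := FD t.
    + exact: (cvg_at_right_filter (Fc 0)).
    + exact: (cvg_at_left_filter (Fc 1)).
  - by move=> t _; rewrite derive1E; have [_ ->] := FD t.
apply: le_integral => //; [exact: (itg f)|exact: (itg g)|].
move=> t _; rewrite lee_fin.
have -> : metric_tensor (c t) (derive1 c t) = sqnorm (derive1 c t).1 / y t ^+ 2 + f t ^+ 2.
  by rewrite /metric_tensor /f exprMn exprVn mulrDl.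
apply: (le_trans (ler_norm _)); rewrite -sqrtr_sqr ler_wsqrtr// lerDr.
by rewrite divr_ge0// ?sqnorm_ge0// sqr_ge0.
Qed.

Lemma unbounded_heights_not_bounded (A : set H) :
  (forall m, exists2 p, A p & m < (\val p).2) -> ~ hyp_bounded A.
Proof.
move=> Ahigh [r Ar]; have [p Ap _] := Ahigh 0.
have [q Aq qr] := Ahigh (expR (r + 1 + ln (\val p).2)).
have := Ar p q Ap Aq; rewrite leNgt => /negP; apply.
apply: (@lt_le_trans _ _ (r + 1)%:E); first by rewrite lte_fin ltrDl.
apply: le_ereal_inf_tmp => _ [c [cC1 c0 c1] <-].
apply: le_trans (curve_length_ge cC1); rewrite c0 c1 lee_fin lerBrDr.
by rewrite -ler_expR lnK ?posrE ?hyp_gt0// ltW.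
Qed.

(** Points of the boundary at height 0 are separated from [A] by the height
    [lambda]; the point at infinity is adherent because heights are bounded on compact
    sets. *)
Lemma closure_ideal_boundary (A : set H) (lambda : R) : 0 < lambda ->
  A `<=` horoball_infty lambda ->
  (forall m, exists2 p, A p & m < (\val p).2) ->
  closure [set hyp_incl p | p in A] `&` ideal_boundary = [set None].
Proof.
move=> l0 Al Ahigh.
have hc : continuous (fun q : closed_halfspace R d => (\val q).2).
  move=> q; apply: (@continuous_comp _ _ _ (fun q : closed_halfspace R d => \val q) snd).
    exact: initial_continuous.
  exact: cvg_snd.
apply/seteqP; split=> [[q|] //= [qA q0]|_ ->].
  exfalso.
  have qN : nbhs q [set r : closed_halfspace R d | (\val r).2 < lambda].
    apply: (hc q [set x | x < lambda]); apply: open_nbhs_nbhs; split.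
      exact: open_lt.
    by rewrite /= q0.
  have [_ [[p Ap <-] [r /= rl [rp]]]] := qA _ (one_point_compactification_some_nbhs _ _ qN).
  by move: rl; rewrite rp ltNge /= => /negP; apply; exact: Al.
split => // B [U [Ucpt _] UB].
have [M [_ HM]] : bounded_set ((fun q : closed_halfspace R d => (\val q).2) @` U).
  apply: compact_bounded; apply: continuous_compact => //.
  exact: continuous_subspaceT.
have [p Ap pM] := Ahigh (Num.max M 0 + 1).
exists (hyp_incl p); split; first by exists p.
apply: UB; left; exists (exist _ (\val p) (hyp_closed_halfspace p)) => // Up.
have /= := HM (Num.max M 0 + 1) _ _ (ex_intro2 _ _ _ Up erefl).
have Mm : M <= Num.max M 0 by rewrite le_max lexx.
have -> : M < Num.max M 0 + 1 by lra.
by move=> /(_ isT) /= /ler_normlP[_]; lra.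
Qed.

End Distance.

(** * Convex hulls of spread configurations in a horoball *)

Section SpreadConfiguration.
Context {R : realType} {d : nat} (d_gt1 : (0 < d.-1)%N).
Local Notation V := 'rV[R]_(d.-1).
Local Notation W := (V * R)%type.
Local Notation H := (hyp R d).
Context (X : set H) (lambda : R) (lambda_gt0 : 0 < lambda).
Hypothesis Xhoro : X `<=` horoball_infty lambda.
Hypothesis Xfin : forall r : R, finite_set (X `&` [set p | `|(\val p).1| <= r]).
Hypothesis Xspread : spread (chord_map @` X).

Local Notation K := (hyp_conv X).
Local Notation X' := (chord_map @` X).
Local Notation a := (lambda ^+ 2).

Let a_ge0 : 0 <= a. Proof. exact: sqr_ge0. Qed.

Let X'above : X' `<=` [set p : W | a + sqnorm p.1 <= p.2].
Proof.
move=> _ [p Xp <-] /=; have := Xhoro Xp; rewrite /horoball_infty /= => lp.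
by rewrite addrC lerD2l lerXn2r// nnegrE ltW// hyp_gt0.
Qed.

Let X'fin (r : R) : finite_set (X' `&` [set p : W | `|p.1| <= r]).
Proof.
apply: sub_finite_set (finite_image chord_map (Xfin r)).
by move=> _ [[p Xp <-] /= pr]; exists p.
Qed.

Lemma spread_hull_horoball : K `<=` horoball_infty lambda.
Proof.
move=> p /image_chord_map; rewrite chord_map_hull => /(hull_above X'above) /=.
rewrite addrC lerD2l => lp.
by rewrite /horoball_infty /= -(@ler_pXn2r _ 2)// nnegrE ltW// hyp_gt0.
Qed.

Lemma continuous_paraboloid_map : continuous (@paraboloid_map R d).
Proof.
move=> p; have c2 : continuous (fun x : ambient R d => sqnorm x.1 + x.2 ^+ 2).
  have -> : (fun x : ambient R d => sqnorm x.1 + x.2 ^+ 2) = sphere_fun 0 0.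
    apply/funext => x; rewrite /sphere_fun /= /dotp big1 ?subr0// => j _.
    by rewrite mxE mul0r.
  exact: continuous_sphere_fun.
have c1 : continuous (fun x : ambient R d => x.1) by move=> x; exact: cvg_fst.
exact: (cvg_pair (c1 p) (c2 p)).
Qed.

Lemma continuous_chord_map : continuous (@chord_map R d).
Proof.
move=> p; apply: (@continuous_comp _ _ _ (fun p : H => \val p)).
  exact: continuous_hyp_val.
exact: continuous_paraboloid_map.
Qed.

Lemma spread_hull_preimage : K = chord_map @^-1` chull X'.
Proof.
by apply/seteqP; split=> p /=; rewrite -chord_map_hull => /image_chord_map.
Qed.

Lemma spread_hull_closed : closed K.
Proof.
rewrite spread_hull_preimage; apply: (continuous_closedP _).1.
  exact: continuous_chord_map.
exact: (hull_closed d_gt1 a_ge0 X'above X'fin Xspread).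
Qed.

Lemma spread_hull_high m : exists2 p, K p & m < (\val p).2.
Proof.
have [M /(_ 0)] := hull_over_cube Xspread 0.
rewrite normr0 => /(_ (lexx _))[h _ Kh].
pose h' := Num.max h ((m ^+ 2 + 1)).
have Kh' : chull X' (0, h').
  by apply: (hull_ray_up d_gt1 a_ge0 X'above Xspread Kh); rewrite le_max lexx.
move: Kh'; rewrite -chord_map_hull => -[p Kp] [p1 p2]; exists p => //.
have sq0 : sqnorm (\val p).1 = 0.
  by rewrite p1 /sqnorm big1// => j _; rewrite mxE expr0n.
rewrite sq0 add0r in p2.
have : m ^+ 2 + 1 <= (\val p).2 ^+ 2 by rewrite p2 le_max lexx orbT.
have := hyp_gt0 p; set y := (\val p).2 => y0 my.
rewrite ltNge; apply/negP => ym; have : y ^+ 2 <= m ^+ 2 by rewrite lerXn2r// nnegrE; lra.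
by lra.
Qed.

(** A boundary point is lowest on its vertical line, so a supporting hyperplane there
    is not vertical and its preimage is a hemisphere. *)
Lemma spread_hull_boundary_support x : K x -> ~ interior K x ->
  exists S, supports_at S K x.
Proof.
move=> Kx nKx; have Kx' : chull X' (chord_map x) by rewrite -chord_map_hull; exists x.
have low h : chull X' ((chord_map x).1, h) -> (chord_map x).2 <= h.
  move=> Kh; rewrite leNgt; apply/negP => hx; apply: nKx.
  have [e e0 eK] := hull_above_point_interior d_gt1 a_ge0 X'above Xspread Kh hx.
  rewrite /interior /= spread_hull_preimage.
  apply: (continuous_chord_map (x := x)); apply/nbhs_ballP; exists e => // q.
  rewrite -ball_normE /= distrC => /ltW qe.
  by apply: eK; apply: le_trans qe; [exact: (norm_fst_le (q - _))|
     exact: (norm_snd_le (q - _))].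
have [b Hb] := hull_supporting_hyperplane Xspread low.
have dotpB v w : dotp b (v - w) = dotp b v - dotp b w.
  have := dotp_comb b v w 1 (-1).
  by rewrite scale1r scaleN1r mul1r mulN1r.
exists (hemisphere b ((chord_map x).2 - dotp b (chord_map x).1)).
apply: hemisphere_supports => //.
  by rewrite /hemisphere /mkset /sphere_fun -!/(chord_map x); lra.
move=> q Kq; have := Hb (chord_map q); rewrite -chord_map_hull dotpB.
move=> /(_ ((image_chord_map _ _).2 Kq)).
by rewrite /sphere_fun -!/(chord_map q); lra.
Qed.

Lemma spread_hull_faces_bounded (r : R) :
  finite_set [set F | face K F /\ F `&` [set p | `|(\val p).1| <= r] !=set0].
Proof.
have fin := cfaces_locally_finite d_gt1 a_ge0 X'above X'fin Xspread r.
apply: sub_finite_set (finite_image (fun F => chord_map @^-1` F) fin).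
move=> F [fF [p [Fp pr]]]; exists (chord_map @` F).
  split; first by rewrite -chord_map_hull; exact/faceP.
  by exists (chord_map p) => //; exists p.
by apply/seteqP; split=> q /=; [move/image_chord_map|exists q].
Qed.

Lemma spread_hull_polyhedron : hyperbolic_polyhedron K.
Proof.
split; first exact: spread_hull_closed; first exact: hyp_conv_convex.
- move=> x [Kx nKx]; apply: spread_hull_boundary_support => //.
  exact: spread_hull_closed.
- move=> C Ccpt.
  have [M [_ HM]] : bounded_set ((fun p : H => (\val p).1) @` C).
    apply: compact_bounded; apply: continuous_compact => //.
    apply: continuous_subspaceT => p.
    apply: (@continuous_comp _ _ _ (fun p : H => \val p) fst).
      exact: continuous_hyp_val.
    exact: cvg_fst.
  apply: sub_finite_set (spread_hull_faces_bounded (M + 1)).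
  move=> F [fF [p [Fp Cp]]]; split => //; exists p; split => //=.
  by apply: HM; [rewrite ltrDl|exists p].
Qed.

(** Every face meets some cube with integer size, and only finitely many meet a given
    one. *)
Lemma spread_hull_faces_countably_infinite :
  ([set F | face K F] #= [set: nat])%card.
Proof.
have inf := cfaces_infinite d_gt1 a_ge0 X'above X'fin Xspread.
apply/card_eqPle; split.
  have -> : [set F | face K F] = \bigcup_(n in [set: nat])
      [set F | face K F /\ F `&` [set p | `|(\val p).1| <= n%:R] !=set0].
    apply/seteqP; split=> [F fF|F [n _ []]//].
    have [[p Fp] _ _ _] := fF.
    exists (Num.truncn `|(\val p).1|).+1 => //; split => //.
    by exists p; split => //=; exact/ltW/truncnS_gt.
  apply: bigcup_countable => // n _.
  exact/finite_set_countable/spread_hull_faces_bounded.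
apply/infiniteP => fin; apply: inf.
apply: sub_finite_set (finite_image (fun F => chord_map @` F) fin) => G fG.
have [_ GK _ _] := fG.
have GE : chord_map @` (chord_map @^-1` G) = G.
  apply/seteqP; split=> [_ [p Gp <-]//|z Gz].
  have := GK z Gz; rewrite -chord_map_hull => -[p Kp pz].
  by exists p => //=; rewrite pz.
by exists (chord_map @^-1` G) => //=; apply/faceP; rewrite GE chord_map_hull.
Qed.

End SpreadConfiguration.

(** * Hyperbolic volumes of boxes in a horoball *)

Lemma lebesgue_rV0 {R : realType} n : lebesgue_rV (set0 : set 'rV[R]_n) = 0%E.
Proof.
elim: n => [|n IH] /=; first by rewrite indic0.
by under eq_integral => x _ do rewrite IH; rewrite integral0.
Qed.

Lemma lebesgue_rV_box {R : realType} n (I : 'I_n -> set R) :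
  (forall j, measurable (I j)) ->
  lebesgue_rV [set v : 'rV[R]_n | forall j, I j (v 0 j)] =
  (\prod_(j < n) lebesgue_measure (I j))%E.
Proof.
elim: n I => [|n IH] I mI /=.
  by rewrite big_ord0 indicE mem_set// => -[].
rewrite big_ord_recl; set c := (\prod_(j < n) _)%E.
transitivity (\int[lebesgue_measure]_(x in I ord0) cst c x)%E; last first.
  by rewrite [RHS]muleC; exact: (@integral_cst _ _ _ (@lebesgue_measure R) _ (mI ord0) c).
rewrite [RHS]integral_mkcond; apply: eq_integral => x _; rewrite patchE.
have e0 (w : 'rV[R]_n) : row_mx (x%:M : 'rV_1) w 0 ord0 = x.
  by rewrite mxE; case: splitP => k //= _; rewrite mxE ord1.
have eS (w : 'rV[R]_n) j : row_mx (x%:M : 'rV_1) w 0 (lift ord0 j) = w 0 j.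
  rewrite mxE; case: splitP => k; rewrite /= /bump/= => kE.
    by have := ltn_ord k; rewrite -kE.
  by congr (w _ _); apply/val_inj; case: kE.
case: ifPn => [/set_mem Ix|/negP Ix].
  rewrite /c /= -IH//; congr lebesgue_rV; apply/seteqP; split=> w /= Iw j.
    by have := Iw (lift ord0 j); rewrite eS.
  by case: (unliftP ord0 j) => [j'|] ->; rewrite ?e0// eS.
rewrite -[RHS](@lebesgue_rV0 R n); congr lebesgue_rV.
apply/seteqP; split=> // w /= /(_ ord0); rewrite e0 => Ix'.
by apply: Ix; exact/mem_set.
Qed.

Section Volume.
Context {R : realType} {d : nat}.
Local Notation V := 'rV[R]_(d.-1).
Local Notation H := (hyp R d).

Definition box_above (I : 'I_(d.-1) -> set R) (lambda : R) : set H :=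
  [set p : H | (forall j, I j ((\val p).1 0 j)) /\ lambda <= (\val p).2].

Lemma hyp_vol_box_above I lambda : 0 < lambda -> (forall j, measurable (I j)) ->
  hyp_vol (box_above I lambda) =
  (\int[lebesgue_measure]_(y in `[lambda, +oo[)
     ((y ^- d)%:E * \prod_(j < d.-1) lebesgue_measure (I j)))%E.
Proof.
move=> l0 mI.
have E : `[lambda, +oo[%classic = `]0, +oo[%classic `&` `[lambda, +oo[%classic :> set R.
  apply/seteqP; split=> [y /=|y [_]//]; rewrite !in_itv/= !andbT => ly.
  by split => //; exact: lt_le_trans ly.
rewrite [in RHS]E [RHS]integral_mkcondr; apply: eq_integral => y /set_mem/=.
rewrite in_itv/= andbT => y0; rewrite patchE -lebesgue_rV_box//.
case: ifPn => [/set_mem|/negP yl].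
  rewrite /= in_itv/= andbT => ly; congr (_ * lebesgue_rV _)%E.
  apply/seteqP; split=> [v [p [pI _] pE] j|v vI].
    by have := pI j; have -> : \val p = (v, y) := pE.
  have y0' : [set p : ambient R d | 0 < p.2] (v, y) by [].
  by exists (exist _ (v, y) (mem_set y0')).
rewrite (_ : [set v | _] = set0) ?lebesgue_rV0 ?mule0//.
apply/seteqP; split=> // v [p [_ pl] pE]; apply: yl; apply/mem_set => /=.
by rewrite in_itv/= andbT; move: pl; have -> : \val p = (v, y) := pE.
Qed.

Lemma inv_pow_integral_lty (lambda : R) : (2 <= d)%N -> 0 < lambda ->
  (\int[lebesgue_measure]_(y in `[lambda, +oo[) (y ^- d)%:E < +oo)%E.
Proof.
move=> d2 l0.
have pos y : (`[lambda, +oo[%classic : set R) y -> 0 < y.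
  by rewrite /= in_itv/= andbT; exact: lt_le_trans.
(* Near infinity [y ^- d] is compared with [y ^- 2], whose primitive is explicit. *)
have sq : (\int[lebesgue_measure]_(y in `[lambda, +oo[) (y^-1 * y^-1)%:E =
    (lambda^-1)%:E)%E.
  rewrite (@ge0_continuous_FTC2y _ (fun y => y^-1 * y^-1) (fun y => - y^-1) lambda 0).
  - by rewrite sub0e EFinN oppeK.
  - by move=> y _; rewrite -expr2 sqr_ge0.
  - apply: continuous_in_subspaceT => y /set_mem /pos y0.
    have Vc : {for y, continuous (@GRing.inv R)} by apply: inv_continuous; rewrite gt_eqF.
    by apply: cvgM; exact: Vc.
  - rewrite -[X in _ --> X]oppr0; apply: cvgN.
    by apply/(@gtr0_cvgV0 _ _ _ _ id); [exact: nbhs_pinfty_gt|exact: cvg_id].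
  - move=> y ly; apply: derivableN; apply: derivableV => //.
    by rewrite gt_eqF// (lt_trans l0).
  - apply: cvgN; apply: cvg_at_right_filter; apply: inv_continuous.
    by rewrite gt_eqF.
  - move=> y; rewrite in_itv/= andbT => ly.
    have y0 : y != 0 by rewrite gt_eqF// (lt_trans l0).
    have HD := is_deriveN (@is_deriveV _ id y 1 1 y0 (is_derive_id y 1)).
    rewrite derive1E; have [_ ->] := HD.
    by rewrite scale_realE mulr1 opprK expr2 invfM.
apply: (@le_lt_trans _ _ ((lambda ^- (d - 2))%:E * (lambda^-1)%:E)%E); last first.
  by rewrite -EFinM ltry.
have minv : measurable_fun (`[lambda, +oo[ : set R) (fun y : R => y^-1).
  apply: subspace_continuous_measurable_fun => //.
  apply: continuous_in_subspaceT => y /set_mem /pos y0.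
  by apply: inv_continuous; rewrite gt_eqF.
rewrite -sq -ge0_integralZl//=.
- apply: ge0_le_integral => //.
  + by move=> y /pos y0; rewrite lee_fin invr_ge0 exprn_ge0// ltW.
  + apply/measurable_EFinP; apply: (eq_measurable_fun (fun y : R => y^-1 ^+ d)).
      by move=> y _; rewrite exprVn.
    exact: measurable_funX.
  + apply/measurable_EFinP; apply: measurable_funM => //.
    exact: measurable_funM.
  + move=> y /[dup] /pos y0; rewrite /= in_itv/= andbT => ly.
    rewrite -EFinM lee_fin -{1}(subnK d2) exprD invfM expr2 invfM.
    rewrite ler_wpM2r//; first by rewrite -expr2 sqr_ge0.
    by rewrite lef_pV2 ?posrE ?exprn_gt0// lerXn2r// nnegrE ltW.
- by apply/measurable_EFinP; exact: measurable_funM.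
- by move=> y _; rewrite lee_fin -expr2 sqr_ge0.
- by rewrite lee_fin invr_ge0 exprn_ge0// ltW.
Qed.

Lemma hyp_vol_cube_above_fin (r lambda : R) : (2 <= d)%N -> 0 < lambda ->
  hyp_vol (box_above (fun=> `[- r, r]%classic) lambda) \is a fin_num.
Proof.
move=> d2 l0; rewrite hyp_vol_box_above//.
set L := (\prod_(j < d.-1) _)%E.
have [l l_ge0 lE] : exists2 l : R, 0 <= l & L = l%:E.
  have [m m0 mE] : exists2 m : R, 0 <= m &
      lebesgue_measure `[- r, r]%classic = m%:E.
    rewrite lebesgue_measure_itv/= lte_fin; case: ifPn => [rr|_]; last by exists 0.
    by exists (r - - r) => //; rewrite subr_ge0 ltW.
  exists (\prod_(j < d.-1) m); first by rewrite prodr_ge0.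
  by rewrite /L -prodEFin; apply: eq_bigr => j _; rewrite mE.
have pos y : (`[lambda, +oo[%classic : set R) y -> 0 <= y ^- d.
  rewrite /= in_itv/= andbT => ly; rewrite invr_ge0 exprn_ge0//.
  exact: le_trans (ltW l0) ly.
under eq_integral do rewrite lE muleC.
rewrite ge0_integralZl//=.
- rewrite fin_numM// ge0_fin_numE ?inv_pow_integral_lty//.
  by apply: integral_ge0 => y /pos y0; rewrite lee_fin.
- apply/measurable_EFinP; apply: subspace_continuous_measurable_fun => //.
  apply: continuous_in_subspaceT => y /set_mem/=; rewrite in_itv/= andbT => ly.
  have y0 : 0 < y := lt_le_trans l0 ly.
  apply: (@continuous_comp _ _ _ (fun y : R => y ^+ d)); first exact: exprn_continuous.
  by apply: inv_continuous; rewrite gt_eqF// exprn_gt0.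
Qed.

(** The horizontal section is infinite at every height, and the density is positive. *)
Lemma hyp_vol_unbounded_box_above (I : 'I_(d.-1) -> set R) lambda :
  (2 <= d)%N -> 0 < lambda -> (forall j, measurable (I j)) ->
  (forall j, lebesgue_measure (I j) = +oo%E) ->
  hyp_vol (box_above I lambda) = +oo%E.
Proof.
move=> d2 l0 mI Ioo; rewrite hyp_vol_box_above//.
have -> : (\prod_(j < d.-1) lebesgue_measure (I j) = +oo)%E.
  case: d d2 I mI Ioo => [|[|n]]// _ I mI Ioo; rewrite /=.
  rewrite big_ord_recl Ioo.
  elim: n I mI Ioo => [|n IH] I mI Ioo; first by rewrite big_ord0 mule1.
  rewrite big_ord_recl Ioo muleA mulyy.
  exact: (IH (fun j => I (lift ord0 j))).
rewrite (eq_integral (cst +oo%E)); last first.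
  move=> y /set_mem/=; rewrite in_itv/= andbT => ly.
  by rewrite gt0_muley// lte_fin invr_gt0 exprn_gt0// (lt_le_trans l0).
have Loo : lebesgue_measure (`[lambda, +oo[%classic : set R) = +oo%E.
  by rewrite lebesgue_measure_itv/= ltry.
by rewrite integral_cst// -[RHS]mulyy; congr (_ * _)%E; exact: Loo.
Qed.

Lemma hyp_borel_closed (A : set H) : closed A -> hyp_borel A.
Proof.
move=> cA; rewrite -(setCK A) -setTD; apply: sigma_algebraCD.
by apply: sub_gen_smallest; exact: closed_openC.
Qed.

Lemma box_above_closed (I : 'I_(d.-1) -> set R) lambda :
  (forall j, closed (I j)) -> closed (box_above I lambda).
Proof.
move=> cI.
have c1 j : continuous (fun p : H => (\val p).1 0 j).
  move=> p; apply: (@continuous_comp _ _ _ (fun p : H => \val p)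
    (fun x : ambient R d => x.1 0 j)); first exact: continuous_hyp_val.
  exact/differentiable_continuous/differentiable_coord_fst.
have c2 : continuous (fun p : H => (\val p).2).
  move=> p; apply: (@continuous_comp _ _ _ (fun p : H => \val p) snd).
    exact: continuous_hyp_val.
  exact: cvg_snd.
have -> : box_above I lambda =
    \bigcap_(j in setT) ((fun p : H => (\val p).1 0 j) @^-1` I j) `&`
    (fun p : H => (\val p).2) @^-1` [set y | lambda <= y].
  apply/seteqP; split=> p [pI pl]; split => //; first by move=> j _; exact: pI.
  by move=> j; exact: pI.
apply: closedI; last exact: ((continuous_closedP _).1 c2 _ (@closed_ge _ _)).
by apply: closed_bigI => j _; exact: ((continuous_closedP _).1 (c1 j)).
Qed.

End Volume.

(** * Almost sure properties of the Poisson process *)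

Section Poisson.
Context {R : realType} {d : nat} {dT : measure_display} {T : measurableType dT}.
Context (P : probability T R) (mu : set (hyp R d) -> \bar R).
Context (eta : T -> set (hyp R d)) (eta_ppp : poisson_point_process P mu eta).

Let npoints_eq (A : set (hyp R d)) k := [set w | npoints (eta w) A = k%:R%:E :> \bar R].

Let npoints_eq_measurable A k : hyp_borel A -> measurable (npoints_eq A k).
Proof.
move=> bA; have [/(_ A bA) mA _ _] := eta_ppp.
by rewrite -[X in measurable X]setTI; exact: (mA measurableT _ (emeasurable_set1 _)).
Qed.

(** The Poisson probabilities of the finite values sum to 1. *)
Lemma poisson_process_ae_finite A : hyp_borel A -> mu A \is a fin_num ->
  {ae P, forall w, finite_set (eta w `&` A)}.
Proof.
move=> bA /fineK muE; have [_ /(_ A _ bA) law _] := eta_ppp.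
pose r := fine (mu A); pose E := \bigcup_k npoints_eq A k.
have mE : measurable E by apply: bigcup_measurable => k _; exact: npoints_eq_measurable.
have PE : P E = 1%E.
  rewrite measure_bigcup//; last 2 first.
  - by move=> k _; exact: npoints_eq_measurable.
  - move=> i j _ _ [w [/= wi wj]]; apply/eqP; rewrite -(eqr_nat R) -eqe.
    by rewrite -wi -wj.
  rewrite -(@probability_setT _ _ _ (poisson_prob r 0)).
  have natE : [set: nat] = \bigcup_(k in [set: nat]) [set k].
    by apply/seteqP; split=> // k _; exists k.
  rewrite [in RHS]natE measure_bigcup//.
  - by apply: eq_eseriesr => k _; apply: etrans (law k) _; rewrite -muE.
  - by move=> i j _ _ [k [/= -> ->]].
exists (~` E); split; first exact: measurableC.
  by rewrite probability_setC// PE subee.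
move=> w /= infw [k _ wk]; apply: infw; apply: contrapT => infw.
by move: wk; rewrite /npoints_eq /= /npoints /counting asboolF.
Qed.

(** With infinite parameter the value 0 has probability 0. *)
Lemma poisson_process_ae_nonempty A : hyp_borel A -> mu A = +oo%E ->
  {ae P, forall w, eta w `&` A !=set0}.
Proof.
move=> bA muA; have [_ /(_ A 0%N bA) law _] := eta_ppp.
exists (npoints_eq A 0); split; first exact: npoints_eq_measurable.
  by apply: etrans law _; rewrite muA.
move=> w /= /set0P/negP/negPn/eqP w0.
by rewrite /npoints_eq /= /npoints w0 /counting asboolT// fset_set0 finmap.cardfs0.
Qed.

End Poisson.

Theorem theorem1 (R : realType) (d : nat) (gamma lambda : R)
    (dT : measure_display) (T : measurableType dT) (P : probability T R)
    (eta : T -> set (hyp R d)) :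
  (2 <= d)%N -> 0 < gamma -> 0 < lambda ->
  poisson_point_process P (fun A => (gamma%:E * hyp_vol A)%E) eta ->
  let K := fun w => hyp_conv (eta w `&` horoball_infty lambda) in
  {ae P, forall w, [/\ closed (K w), ~ hyp_bounded (K w),
                       hyperbolic_polyhedron (K w)
                     & ([set F | face (K w) F] #= [set: nat])%card]} /\
  {ae P, forall w,
     closure [set hyp_incl p | p in K w] `&` ideal_boundary = [set None]}.
Proof.
move=> d2 gamma0 lambda0 ppp K.
have d_gt1 : (0 < d.-1)%N by case: d d2 {eta ppp K} => [|[]].
have fin (n : nat) : {ae P, forall w, finite_set (eta w `&`
    box_above (fun=> `[- n%:R, n%:R]%classic) lambda)}.
  apply: (poisson_process_ae_finite ppp).
    by apply: hyp_borel_closed; apply: box_above_closed => j; exact: interval_closed.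
  by rewrite fin_numM// hyp_vol_cube_above_fin.
pose orthant (n : nat) (e : {ffun 'I_(d.-1) -> bool}) (j : 'I_(d.-1)) : set R :=
  if e j then `]-oo, - n%:R]%classic else `[n%:R, +oo[%classic.
have spr (n : nat) : {ae P, forall w, forall e,
    eta w `&` box_above (orthant n e) lambda !=set0}.
  apply: filter_forall => e; apply: (poisson_process_ae_nonempty ppp).
    apply: hyp_borel_closed; apply: box_above_closed => j; rewrite /orthant.
    by case: (e j); exact: interval_closed.
  rewrite hyp_vol_unbounded_box_above ?gt0_muley// => j; rewrite /orthant.
    by case: (e j).
  by case: (e j); rewrite lebesgue_measure_itv/= ?ltNyr ?ltry.
have {}fin := ae_foralln fin; have {}spr := ae_foralln spr.
have good : {ae P, forall w,
    (forall r : R, finite_set (eta w `&` horoball_infty lambda `&`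
       [set p | `|(\val p).1| <= r])) /\
    spread (chord_map @` (eta w `&` horoball_infty lambda))}.
  apply: filterS2 fin spr => w finw sprw; split=> r.
    have rn := truncnS_gt r; set n := (Num.truncn r).+1 in rn.
    apply: sub_finite_set (finw n) => p [[wp lp] /= pr]; split => //; split => // j.
    rewrite /= in_itv/= -ler_norml (le_trans (normr_coord _ _))//.
    exact: le_trans pr (ltW rn).
  move=> e; have rn := truncnS_gt r; set n := (Num.truncn r).+1 in rn.
  have [p [wp [pe lp]]] := sprw n (finfun e); exists (chord_map p); first by exists p.
  move=> j; apply: (le_trans (ltW rn)); have := pe j.
  rewrite /orthant ffunE /chord_map /=; case: (e j); rewrite /= in_itv/=.
    by rewrite expr1 mulN1r lerNr.
  by rewrite andbT expr0 mul1r.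
split; apply: filterS good => w [finw sprw].
  have sub : eta w `&` horoball_infty lambda `<=` horoball_infty lambda by move=> p [].
  split.
  - by have := spread_hull_closed d_gt1 lambda0 sub finw sprw.
  - have high := spread_hull_high d_gt1 lambda0 sub sprw.
    exact: unbounded_heights_not_bounded high.
  - by have := spread_hull_polyhedron d_gt1 lambda0 sub finw sprw.
  - by have := spread_hull_faces_countably_infinite d_gt1 lambda0 sub finw sprw.
have sub : eta w `&` horoball_infty lambda `<=` horoball_infty lambda by move=> p [].
apply: (closure_ideal_boundary lambda0); first exact: spread_hull_horoball.
exact: (spread_hull_high d_gt1 lambda0 sub sprw).
Qed.
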